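(* Let $\{X_n, n\ge 1\}$ be a sequence of i.i.d. random variables with nondegenerate common distribution function $F$, $E(X_1)=0$ and $E(X_1^2)=1$. Let $M_n=\max(X_1,\dots,X_n)$, let $M_n^{(k)}$ be the $k$-th maximum of $\{X_1,\dots,X_n\}$, and let $S_n=\sum_{i=1}^nX_i$. Suppose that there exist constants $a_n>0$, $b_n\in\mathbb{R}$, $n\ge 1$, such that $$\lim_{n\to\infty}P(a_n(M_n-b_n)\le x)=G(x)\quad\text{for all } x\in\mathbb{R},$$ where $G$ is one of the extreme value distributions $\Lambda$, $\Phi_\alpha$ for some $\alpha>2$, or $\Psi_\alpha$ for some $\alpha>0$. Then for every fixed integer $k\ge1$ and any $x,y\in\mathbb{R}$, $$\lim_{n\to\infty}P\left(a_n(M_n^{(k)}-b_n)\le x,\ \frac{S_n}{\sqrt n}\le y\right)=G(x)\sum_{i=0}^{k-1}\frac{(-\ln G(x))^i}{i!}\,\Phi(y).$$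
   Context: Extreme value distributions: $\Lambda(x)=\exp(-e^{-x})$ for $x\in\mathbb{R}$; $\Phi_\alpha(x)=0$ for $x\le 0$ and $\Phi_\alpha(x)=\exp(-x^{-\alpha})$ for $x>0$; $\Psi_\alpha(x)=\exp(-(-x)^\alpha)$ for $x\le 0$ and $\Psi_\alpha(x)=1$ for $x>0$. $\Phi$ (no subscript) is the standard normal distribution function. $M_n^{(k)}$ is the $k$-th largest value among $X_1,\dots,X_n$ counted with multiplicity (for $n\ge k$), so $M_n^{(1)}=M_n$. Conventions: the right-hand side is read as $0$ when $G(x)=0$, and $0^0=1$. *)

(* Defs.v *)
From HB Require Import structures.
From mathcomp Require Import all_boot all_order all_algebra finmap.
From mathcomp Require Import all_classical all_reals all_analysis.

Set Implicit Arguments.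
Unset Strict Implicit.
Unset Printing Implicit Defensive.

Import Order.TTheory GRing.Theory Num.Theory.
Import numFieldNormedType.Exports.

Local Open Scope classical_set_scope.
Local Open Scope ring_scope.

Definition mutually_independent (d : measure_display) (T : measurableType d)
    (R : realType) (P : probability T R) (X : nat -> {RV P >-> R}) : Prop :=
  forall (I : {fset nat}) (A : nat -> set R), (forall i, measurable (A i)) ->
    P (\bigcap_(i in [set` I]) (X i @^-1` A i)) =
    (\prod_(i <- I) P (X i @^-1` A i))%E.

Definition degenerate_df (R : realType) (F : R -> R) : Prop :=
  exists c : R, forall x : R, F x = if c <= x then 1 else 0.

Section ExtremeValueDistributions.
Variable R : realType.

Definition gumbel_df (x : R) : R := expR (- expR (- x)).

Definition frechet_df (alpha x : R) : R :=
  if x <= 0 then 0 else expR (- x `^ (- alpha)).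

Definition weibull_df (alpha x : R) : R :=
  if x <= 0 then expR (- (- x) `^ alpha) else 1.

Definition std_normal_df (y : R) : R := fine (normal_prob 0 1 `]-oo, y]).

End ExtremeValueDistributions.

(* A sample X_1, X_2, ... is stored with indices starting at 0: X i is X_(i+1),
   so that i < n ranges over X_1, ..., X_n. *)
Section SampleFunctionals.
Variables (T : Type) (R : realType) (X : nat -> T -> R).

Definition partial_sum (n : nat) (w : T) : R := \sum_(i < n) X i w.

(* The starting value X 0 w is one of the sample values as soon as 0 < n. *)
Definition sample_max (n : nat) (w : T) : R :=
  \big[Num.max/X 0%N w]_(i < n) X i w.

(* For 1 <= k <= n, the k-th largest of the first n values, counted with
   multiplicity; the default value 0 is returned only when n < k. *)
Definition kth_max (k n : nat) (w : T) : R :=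
  nth 0 (sort >=%R [seq X i w | i <- iota 0 n]) k.-1.

Lemma kth_max1 (n : nat) (w : T) :
  (0 < n)%N -> kth_max 1 n w = sample_max n w.
Proof.
move=> n0; rewrite /kth_max /sample_max/= -(big_mkord xpredT (X^~ w)).
rewrite /index_iota subn0 -(big_map (X^~ w) xpredT idfun).
set s := [seq _ | _ <- _].
have X0s : X 0%N w \in s by apply/mapP; exists 0%N; rewrite ?mem_iota.
have tot : total (>=%R : rel R) by move=> a b; exact: le_total.
have := sort_sorted tot s; have sE := perm_sort >=%R s.
have := @perm_mem _ _ s (permEl sE); case: (sort _ s) => [/(_ (X 0%N w))|a t memE at_sorted].
  by rewrite X0s.
have as_ : a \in s by rewrite -memE mem_head.
apply/eqP; rewrite eq_le; apply/andP; split.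
  exact: (@le_bigmax_seq _ _ _ _ _ _ xpredT idfun as_ isT).
have ub b : b \in s -> b <= a.
  rewrite -memE inE => /predU1P[->//|bt].
  have tr : transitive (>=%R : rel R) by move=> u v z vu /le_trans; apply.
  by move: at_sorted; rewrite /= (path_sortedE tr) => /andP[/allP/(_ _ bt)].
by rewrite big_seq; apply: bigmax_le => [|i /ub//]; exact: ub.
Qed.

End SampleFunctionals.

(* Main.v *)
(** Write [u = b_n + x / a_n] and [p = P(X_1 > u)].  The event
    [a_n (M_n^(k) - b_n) <= x] says that fewer than [k] of [X_1, ..., X_n] exceed
    [u], and if [G x > 0] the assumption on [M_n] amounts to [(1 - p)^n --> G x],
    i.e. [n p --> - ln (G x)]; nothing else about [G] matters.  The pair (number
    of exceedances, partial sum) is a Markov chain, and Lindeberg's replacement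
    argument applies to it.  The test functions [r |-> Phi ((y - r) / sqrt s)]
    solve the heat equation in [s], so that replacing one summand by a Gaussian one
    just shifts [s] by [1 / n], without any convolution of normal laws.  A step on
    which [X_i > u] costs only [E(|X_1|; X_1 > u) / sqrt n = o(1 / n)], hence
    the exceedances decouple from the sum.  Thus
    [E(Phi ((y - S_n / sqrt n) / sigma); fewer than k exceedances)] is, up to
    [o(1)], the binomial probability of fewer than [k] successes times
    [Phi (y / sqrt (1 + sigma^2))]; Poisson's limit theorem and [sigma --> 0]
    conclude.  If [G x = 0], then [G] is a Frechet law, and the result follows by
    monotonicity from points [x' > x] with [G x'] small. *)

Require Import Defs.
From HB Require Import structures.
From mathcomp Require Import all_boot all_order all_algebra finmap.
From mathcomp Require Import all_classical all_reals all_analysis.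
From mathcomp Require Import measurable_realfun ring lra.

Import Order.TTheory GRing.Theory Num.Theory.
Import numFieldNormedType.Exports.

Local Open Scope classical_set_scope.
Local Open Scope ring_scope.

Set Implicit Arguments.
Unset Strict Implicit.
Unset Printing Implicit Defensive.

(** * The standard normal distribution function *)

Section MeanValue.
Variable R : realType.
Implicit Types (f df : R -> R).

(** Writing the intermediate point as [a + t * (b - a)] covers both orders of [a] and [b], as well
    as [a = b], without a case distinction in later estimates. *)
Lemma mean_value f df (a b : R) : (forall x : R, is_derive x 1 f (df x)) ->
  exists2 t, 0 <= t <= 1 & f b - f a = df (a + t * (b - a)) * (b - a).
Proof.
move=> fdf.
have cf x : {for x, continuous f}.
  by apply: differentiable_continuous; apply/derivable1_diffP; have [] := fdf x.
have within_cf u v : {within `[u, v], continuous f}.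
  by apply: continuous_subspaceT => x; exact: cf.
have [ab|ba|<-] := ltgtP a b; last by exists 0; rewrite ?lexx ?ler01// !subrr mulr0.
- have [c] := MVT ab (fun x _ => fdf x) (within_cf a b).
  rewrite in_itv/= => /andP[ac cb] ->.
  have ba0 : b - a != 0 by rewrite subr_eq0 gt_eqF.
  exists ((c - a) / (b - a)); last by rewrite divfK// subrKC.
  by rewrite divr_ge0 ?ler_pdivrMr ?mul1r ?lerD2r ?subr_ge0 ?subr_gt0// !ltW.
- have [c] := MVT ba (fun x _ => fdf x) (within_cf b a).
  rewrite in_itv/= => /andP[bc ca] E.
  have ba0 : b - a != 0 by rewrite subr_eq0 lt_eqF.
  exists ((c - a) / (b - a)); last first.
    by rewrite divfK// subrKC -opprB E -mulrN opprB.
  rewrite -mulrNN -invrN !opprB divr_ge0 ?subr_ge0 ?(ltW ca) ?(ltW ba)//=.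
  by rewrite ler_pdivrMr ?subr_gt0// mul1r lerD2l lerN2 ltW.
Qed.

(** The mean value theorem from [0]. Giving up the factor [1 / n.+1] keeps [K] unchanged under
    iteration, which is enough for Taylor remainders. *)
Lemma derive_bound_exp f df (K : R) n : (forall x : R, is_derive x 1 f (df x)) ->
  0 <= K -> f 0 = 0 -> (forall x, `|df x| <= K * `|x| ^+ n) ->
  forall x, `|f x| <= K * `|x| ^+ n.+1.
Proof.
move=> fdf K0 f0 dfK x; have [t /andP[t0 t1]] := mean_value 0 x fdf.
rewrite f0 add0r !subr0 => ->; rewrite normrM exprSr mulrA.
apply: ler_wpM2r => //; apply: (le_trans (dfK _)); apply: ler_wpM2l => //.
rewrite lerXn2r ?nnegrE// normrM ger0_norm//.
by rewrite ler_piMl.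
Qed.

End MeanValue.

Section StandardNormal.
Variable R : realType.
Implicit Types x y z t : R.
Local Notation Phi := (@std_normal_df R).

Definition std_normal_pdf z : R := normal_pdf 0 1 z.
Local Notation phi := std_normal_pdf.

Lemma std_normal_pdfE z : phi z = normal_peak 1 * expR (- (z ^+ 2 / 2)).
Proof.
by rewrite /phi normal_pdfE ?oner_neq0// /normal_fun subr0 expr1n mulNr.
Qed.

Lemma is_derive_std_normal_df z : is_derive z 1 Phi (phi z).
Proof.
have zz : z < z + 1 by rewrite ltrDl.
have int : lebesgue_measure.-integrable [set` Interval -oo%O (BRight (z + 1))]
    (EFin \o @normal_pdf R 0 1).
  by apply: (integrableS _ _ (subsetT _)) => //; exact: integrable_normal_pdf.
have [|d1 d2] := continuous_FTC1 zz int (ltNyr z).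
  exact: continuous_normal_pdf (oner_neq0 _) z.
apply: DeriveDef; first exact: d1.
by rewrite -derive1E.
Qed.

Lemma is_derive_std_normal_pdf z : is_derive z 1 phi (- z * phi z).
Proof.
rewrite (_ : phi = fun x => normal_peak 1 * expR (- (x ^+ 2 / 2))); last first.
  by apply/funext => x; rewrite std_normal_pdfE.
apply: is_derive_eq.
rewrite /GRing.scale/=; lra.
Qed.


Lemma std_normal_pdf_ge0 z : 0 <= phi z.
Proof. exact: normal_pdf_ge0. Qed.

Lemma normal_peak1_le1 : normal_peak (1 : R) <= 1.
Proof.
have s1 : 1 <= Num.sqrt (pi *+ 2 : R).
  by rewrite -[leLHS]sqrtr1 ler_wsqrtr// mulr2n; have := pi_ge2 R; lra.
by rewrite /normal_peak expr1n mul1r invf_le1// (lt_le_trans ltr01).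
Qed.

Lemma std_normal_pdf_le z : phi z <= (1 + z ^+ 2 / 2)^-1.
Proof.
rewrite std_normal_pdfE expRN.
apply: (@le_trans _ _ (1 * (expR (z ^+ 2 / 2))^-1)).
  by rewrite ler_wpM2r ?invr_ge0 ?expR_ge0// normal_peak1_le1.
rewrite mul1r lef_pV2 ?posrE ?expR_gt0 ?expR_ge1Dx//.
by rewrite ltr_pwDl// divr_ge0// sqr_ge0.
Qed.

(** The quadratic term of the exponential series at [z ^+ 2 / 2]. The quartic denominator serves to
    absorb a factor [|z| ^+ 3]. *)
Lemma std_normal_pdf_le4 z : phi z <= (1 + z ^+ 4 / 8)^-1.
Proof.
rewrite std_normal_pdfE expRN.
apply: (@le_trans _ _ (1 * (expR (z ^+ 2 / 2))^-1)).
  by rewrite ler_wpM2r ?invr_ge0 ?expR_ge0// normal_peak1_le1.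
rewrite mul1r lef_pV2 ?posrE ?expR_gt0//; last first.
  by rewrite ltr_pwDl// divr_ge0// exprn_even_ge0.
have z0 : 0 <= z ^+ 2 / 2 by rewrite divr_ge0// sqr_ge0.
apply: le_trans (expR_ge1Dxn 1 z0).
rewrite lerD2l (_ : 2`! = 2)%N//; nra.
Qed.

Lemma std_normal_pdf_le1 z : phi z <= 1.
Proof.
apply: (le_trans (std_normal_pdf_le _)).
by rewrite invf_le1 ?ler_wpDr// ?ltr_pwDl// divr_ge0// sqr_ge0.
Qed.

Lemma std_normal_pdf_id_le1 z : `|z * phi z| <= 1.
Proof.
have d0 : 0 < 1 + z ^+ 2 / 2 by rewrite ltr_pwDl// divr_ge0// sqr_ge0.
rewrite normrM (ger0_norm (std_normal_pdf_ge0 _)).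
apply: (@le_trans _ _ (`|z| * (1 + z ^+ 2 / 2)^-1)).
  by rewrite ler_wpM2l// std_normal_pdf_le.
rewrite ler_pdivrMr// mul1r -real_normK ?num_real//.
have := sqr_ge0 (`|z| - 1); nra.
Qed.

Lemma std_normal_pdf_sqrB1_le2 z : `|(z ^+ 2 - 1) * phi z| <= 2.
Proof.
have z0 := sqr_ge0 z.
have d0 : 0 < 1 + z ^+ 2 / 2 by rewrite ltr_pwDl// divr_ge0// sqr_ge0.
rewrite normrM (ger0_norm (std_normal_pdf_ge0 _)).
apply: (@le_trans _ _ (`|z ^+ 2 - 1| * (1 + z ^+ 2 / 2)^-1)).
  by rewrite ler_wpM2l// std_normal_pdf_le.
rewrite ler_pdivrMr// ler_norml; apply/andP; split; lra.
Qed.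

Lemma std_normal_pdf_cube_le8 z : `|z| ^+ 3 * phi z <= 8.
Proof.
have d0 : 0 < 1 + z ^+ 4 / 8 by rewrite ltr_pwDl// divr_ge0// exprn_even_ge0.
apply: (@le_trans _ _ (`|z| ^+ 3 * (1 + z ^+ 4 / 8)^-1)).
  by rewrite ler_wpM2l ?exprn_ge0// std_normal_pdf_le4.
rewrite ler_pdivrMr// -[z ^+ 4]ger0_norm ?exprn_even_ge0// normrX.
have t0 : 0 <= `|z| by [].
set t := `|z| in t0 *.
have [t1|t1] := leP t 1.
  have : t ^+ 3 <= 1 by rewrite exprn_ile1.
  have : 0 <= t ^+ 4 by rewrite exprn_ge0.
  lra.
have : t ^+ 3 <= t ^+ 4 by rewrite ler_weXn2l// ltW.
lra.
Qed.

Lemma is_derive_shift (f df : R -> R) z : (forall x : R, is_derive x 1 f (df x)) ->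
  forall x : R, is_derive x 1 (fun t => f (z + t)) (df (z + x)).
Proof.
move=> fdf x; have fzx := fdf (z + x).
have h : is_derive x 1 (fun t => z + t) (1 : R).
  by apply: is_derive_eq; rewrite add0r mulr1.
by have := @is_derive1_comp _ f (fun t => z + t) x _ _ fzx h; rewrite mulr1.
Qed.

(** The third derivative of [Phi] is bounded by [2], whence a cubic bound; the second is bounded by
    [1], whence a quadratic one. Their minimum is what can be integrated when only a second moment
    is finite. *)
Lemma std_normal_taylor z h :
  `|Phi (z + h) - Phi z - phi z * h + z * phi z * h ^+ 2 / 2|
    <= 2 * (h ^+ 2 * Num.min 1 `|h|).
Proof.
(* [g1] is the remainder as a function of the increment, [g2] and [g3] are its first two
   derivatives, and [d2] at [z + t] is the third. All of [g1], [g2], [g3] vanish at [0]. *)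
pose d2 x : R := (x ^+ 2 - 1) * phi x.
pose g3 t := - (z + t) * phi (z + t) + z * phi z.
pose g2 t := phi (z + t) - phi z + z * phi z * t.
pose g1 t := Phi (z + t) - Phi z - phi z * t + z * phi z * t ^+ 2 / 2.
have dphi := is_derive_shift z (@is_derive_std_normal_pdf).
have dPhi := is_derive_shift z (@is_derive_std_normal_df).
have dg3 (x : R) : is_derive x 1 g3 (d2 (z + x)).
  rewrite /g3; have := dphi x => dphix; apply: is_derive_eq.
  by rewrite /d2 /GRing.scale/=; ring.
have dg2 (x : R) : is_derive x 1 g2 (g3 x).
  rewrite /g2; have := dphi x => dphix; apply: is_derive_eq.
  by rewrite /g3 /GRing.scale/=; ring.
have dg1 (x : R) : is_derive x 1 g1 (g2 x).
  rewrite /g1; have := dPhi x => dphix; apply: is_derive_eq.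
  by rewrite /g2 /GRing.scale/=; field.
have b3 x : `|g3 x| <= 2 * `|x| ^+ 1.
  apply: (derive_bound_exp (n := 0) dg3) => //.
    by rewrite /g3 addr0; ring.
  by move=> t; rewrite mulr1; exact: std_normal_pdf_sqrB1_le2.
have b2 x : `|g2 x| <= 2 * `|x| ^+ 2.
  by apply: (derive_bound_exp (n := 1) dg2 _ _ b3) => //; rewrite /g2 addr0; ring.
have b1 x : `|g1 x| <= 2 * `|x| ^+ 3.
  by apply: (derive_bound_exp (n := 2) dg1 _ _ b2) => //; rewrite /g1 addr0; field.
have b2' x : `|g2 x| <= 2 * `|x| ^+ 1.
  apply: (derive_bound_exp (n := 0) dg2) => //; first by rewrite /g2 addr0; ring.
  move=> t; rewrite mulr1 /g3 (le_trans (ler_normD _ _))//.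
  by rewrite mulNr normrN (_ : 2 = 1 + 1)// lerD// std_normal_pdf_id_le1.
have b1' x : `|g1 x| <= 2 * `|x| ^+ 2.
  by apply: (derive_bound_exp (n := 1) dg1 _ _ b2') => //; rewrite /g1 addr0; field.
have [h1|h1] := leP 1 `|h|.
  by rewrite mulr1 (le_trans (b1' h))// real_normK ?num_real.
by rewrite (le_trans (b1 h))// exprSr real_normK ?num_real.
Qed.

(* With [m = sqrt (1 + th)] one has [1 / m - 1 = - th / 2 + O(th^2)]; the second
   order term of the expansion of [Phi] at [z] is uniformly small because
   [|z|^3 phi z] is bounded. *)
Lemma std_normal_scale z th : 0 <= th <= 1 ->
  `|Phi (z / Num.sqrt (1 + th)) - Phi z + z * phi z * th / 2| <= 3 * th ^+ 2.
Proof.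
move=> /andP[th0 th1]; set m := Num.sqrt _.
have m2 : m ^+ 2 = 1 + th by rewrite sqr_sqrtr// addr_ge0.
have m1 : 1 <= m by rewrite -[leLHS]sqrtr1 ler_sqrt ?lerDl// addr_ge0.
have m0 : 0 < m by lra.
have mth : m - 1 <= th / 2 by nra.
have [t /andP[t0 t1] E] := mean_value z (z / m) (@is_derive_std_normal_df).
set c := z + _ in E.
have [s /andP[s0 s1] E'] := mean_value z c (@is_derive_std_normal_pdf).
set c' := z + _ in E'.
pose r := (m - 1) / m.
have r0 : 0 <= r by rewrite divr_ge0 ?subr_ge0// ltW.
have r1 : r <= 1 - m^-1 by rewrite /r mulrBl divff ?gt_eqF// mul1r.
have zm : z / m - z = - z * r.
  by rewrite /r; field; rewrite gt_eqF.
have cz : c - z = - z * (t * r) by rewrite /c zm; ring.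
have c'z : c' = z * (1 - s * t * r) by rewrite /c' cz; ring.
have str : s * t * r <= r.
  by rewrite ler_piMl// mulr_ile1.
(* The point [c'] lies between [z / m] and [z]. Hence [z ^+ 2] can be traded for [c' ^+ 2] in the
   second order term, whose density is evaluated at [c'], and the bound on the cubic moment applies
   there. *)
have c'm : `|z| <= m * `|c'|.
  rewrite c'z normrM mulrCA ler_peMr//.
  apply: (@le_trans _ _ (m * (1 - s * t * r))); last first.
    by rewrite ler_wpM2l ?(ltW m0)// ler_norm.
  have : m^-1 <= 1 - s * t * r by lra.
  by rewrite -(ler_pM2l m0) divff ?gt_eqF.
have -> : Phi (z / m) - Phi z + z * phi z * th / 2 =
    z * phi z * (th / 2 - r) + (phi c - phi z) * (- z * r).
  by rewrite E zm; ring.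
rewrite E' cz.
have rm : r = (m - 1) / m by [].
have b1 : `|th / 2 - r| <= th ^+ 2.
  have -> : th / 2 - r = (m - 1) ^+ 2 * (m + 2) / (2 * m).
    rewrite /r (_ : th = m ^+ 2 - 1); last by rewrite m2; ring.
    by field; rewrite gt_eqF.
  rewrite ger0_norm; last first.
    by rewrite divr_ge0 ?mulr_ge0 ?sqr_ge0//; lra.
  rewrite ler_pdivrMr; last by lra.
  have h1 : (m - 1) ^+ 2 <= (th / 2) ^+ 2 by rewrite lerXn2r ?nnegrE//; lra.
  apply: (@le_trans _ _ ((th / 2) ^+ 2 * (m + 2))).
    by rewrite ler_wpM2r//; lra.
  have := sqr_ge0 th; nra.
have rth : r <= th / 2.
  by apply: le_trans mth; rewrite /r ler_pdivrMr// ler_peMr// subr_ge0.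
have b2 : `|(- c' * phi c' * (- z * (t * r))) * (- z * r)| <= 2 * th ^+ 2.
  have -> : - c' * phi c' * (- z * (t * r)) * (- z * r) =
            - (c' * phi c' * z ^+ 2 * (t * r ^+ 2)) by ring.
  have p0 := std_normal_pdf_ge0 c'.
  rewrite normrN normrM (ger0_norm (mulr_ge0 t0 (sqr_ge0 r))) normrM.
  rewrite (ger0_norm (sqr_ge0 z)) normrM (ger0_norm p0).
  apply: (@le_trans _ _ (`|c'| * phi c' * (m * `|c'|) ^+ 2 * (1 * r ^+ 2))).
    apply: ler_pM;
      [exact: mulr_ge0 (mulr_ge0 _ p0) (sqr_ge0 z)|exact: mulr_ge0 (sqr_ge0 r)| |].
      rewrite ler_wpM2l ?mulr_ge0// -(real_normK (num_real z)).
      by rewrite lerXn2r ?nnegrE ?mulr_ge0// ltW.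
    by rewrite ler_wpM2r// sqr_ge0.
  have -> : `|c'| * phi c' * (m * `|c'|) ^+ 2 * (1 * r ^+ 2) =
    (`|c'| ^+ 3 * phi c') * (m - 1) ^+ 2.
    by rewrite /r; field; rewrite gt_eqF.
  apply: (@le_trans _ _ (8 * (th / 2) ^+ 2)); last first.
    by rewrite le_eqVlt; apply/orP; left; apply/eqP; field.
  apply: ler_pM; rewrite ?sqr_ge0 ?mulr_ge0 ?exprn_ge0 ?std_normal_pdf_cube_le8//.
  by rewrite lerXn2r ?nnegrE//; lra.
apply: (le_trans (ler_normD _ _)).
rewrite (_ : 3 * th ^+ 2 = 1 * th ^+ 2 + 2 * th ^+ 2); last by ring.
by rewrite lerD// normrM ler_pM// std_normal_pdf_id_le1.
Qed.

Lemma std_normal_df_lipschitz x y : `|Phi x - Phi y| <= `|x - y|.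
Proof.
have [t _ ->] := mean_value y x (@is_derive_std_normal_df).
rewrite normrM ler_piMl// ger0_norm ?std_normal_pdf_ge0//.
exact: std_normal_pdf_le1.
Qed.

Lemma continuous_std_normal_df : continuous Phi.
Proof.
move=> z; apply: differentiable_continuous; apply/derivable1_diffP.
by have [] := is_derive_std_normal_df z.
Qed.

Lemma measurable_std_normal_df : measurable_fun setT Phi.
Proof.
apply: measurable_realfun.continuous_measurable_fun.
exact: continuous_std_normal_df.
Qed.

Lemma std_normal_df_ge0 z : 0 <= Phi z.
Proof. by rewrite fine_ge0// measure_ge0. Qed.

Lemma std_normal_dfK z : (Phi z)%:E = normal_prob 0 1 `]-oo, z].
Proof. by rewrite fineK// fin_num_measure. Qed.

Lemma std_normal_df_le1 z : Phi z <= 1.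
Proof. by rewrite -lee_fin std_normal_dfK probability_le1. Qed.

Lemma std_normal_df_nondecreasing : {homo Phi : x y / x <= y}.
Proof.
move=> x y xy; rewrite -lee_fin !std_normal_dfK le_measure ?inE//.
by apply: subset_itvl; rewrite bnd_simp.
Qed.

(** As a random variable under the standard normal law, the identity has [Phi] as its cdf; this
    yields the limits of [Phi] at both infinities. *)
Let idTR : measurableTypeR R -> R := idfun.

#[local] HB.instance Definition _ :=
  @isMeasurableFun.Build _ _ _ _ idTR (@measurable_id _ _ setT).

Lemma std_normal_df_cvgy : Phi x @[x --> +oo] --> (1 : R).
Proof. exact/fine_cvg/(cvg_cdfy1 (idTR : {RV (normal_prob 0 1) >-> R})). Qed.

Lemma std_normal_df_cvgNy : Phi x @[x --> -oo] --> (0 : R).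
Proof. exact/fine_cvg/(cvg_cdfNy0 (idTR : {RV (normal_prob 0 1) >-> R})). Qed.

End StandardNormal.

(** * One replacement step *)

Lemma integrable_bounded_by d (U : measurableType d) (R : realType)
    (m : probability U R) (f : U -> R) (K : R) (A : set U) :
  measurable A -> measurable_fun setT f -> (forall x, `|f x| <= K) ->
  m.-integrable A (EFin \o f).
Proof.
move=> mA mf fK; apply: (@le_integrable _ _ _ _ _ mA _ (cst K%:E)).
- by apply/measurable_EFinP; exact: measurable_funTS.
- by move=> x _; rewrite /= lee_fin (le_trans (fK x))// ler_norm.
- exact: finite_measure_integrable_cst.
Qed.

Lemma integrable_scale d (U : measurableType d) (R : realType)
    (m : {measure set U -> \bar R}) (f : U -> R) (k : R) (A : set U) :
  measurable A ->
  m.-integrable A (EFin \o f) -> m.-integrable A (EFin \o (fun x => k * f x)).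
Proof. by move=> mA /(integrableZl mA k). Qed.

Lemma integrable_add d (U : measurableType d) (R : realType)
    (m : {measure set U -> \bar R}) (f g : U -> R) (A : set U) : measurable A ->
  m.-integrable A (EFin \o f) -> m.-integrable A (EFin \o g) ->
  m.-integrable A (EFin \o (fun x => f x + g x)).
Proof. by move=> mA /(integrableD mA) h /h. Qed.

Section OneStep.
Variables (R : realType) (mu : probability R R).
Local Notation Phi := (@std_normal_df R).
Local Notation phi := (@std_normal_pdf R).

(** A continuous substitute for Lindeberg's functional E(X^2; |X| > 1/k): up to the factor
    [2 * k ^+ 2] it is the mean of the bound of [std_normal_taylor] at the increment [k * x]. *)
Definition truncated_moment (k : R) : R :=
  \int[mu]_x (x ^+ 2 * Num.min 1 (k * `|x|)).

Hypothesis int2 : mu.-integrable setT (EFin \o (fun x : R => x ^+ 2)).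

Lemma integrable_le_sqr (f : R -> R) (a b : R) (A : set R) :
  measurable A -> measurable_fun setT f ->
  (forall x, `|f x| <= a + b * x ^+ 2) -> mu.-integrable A (EFin \o f).
Proof.
move=> mA mf fK.
apply: (@le_integrable _ _ _ _ _ mA _ (EFin \o (fun x => a + b * x ^+ 2))).
- by apply/measurable_EFinP; exact: measurable_funTS.
- by move=> x _; rewrite /= lee_fin (le_trans (fK x))// ler_norm.
- apply: integrable_add => //; first exact: finite_measure_integrable_cst.
  by apply: integrable_scale => //; exact: integrableS int2.
Qed.

Lemma normr_le_sqr (x : R) : `|x| <= 1 + 1 * x ^+ 2.
Proof.
by rewrite -(real_normK (num_real x)); have := sqr_ge0 (`|x| - 1); nra.
Qed.

Lemma integrable_id A : measurable A -> mu.-integrable A (EFin \o (@id R)).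
Proof.
by move=> mA; apply: (integrable_le_sqr (a := 1) (b := 1)) => //; exact: normr_le_sqr.
Qed.

Lemma integrable_normr A : measurable A -> mu.-integrable A (EFin \o (@Num.norm _ R)).
Proof.
move=> mA; apply: (integrable_le_sqr (a := 1) (b := 1)) => //.
by move=> x; rewrite normr_id; exact: normr_le_sqr.
Qed.

Lemma measurable_truncated (k : R) :
  measurable_fun setT (fun x : R => x ^+ 2 * Num.min 1 (k * `|x|)).
Proof.
apply: measurable_funM; first exact: measurable_funX.
apply: measurable_minr => //; apply: measurable_funM => //.
Qed.

Lemma normr_truncated (k x : R) : 0 <= k ->
  `|x ^+ 2 * Num.min 1 (k * `|x|)| <= 0 + 1 * x ^+ 2.
Proof.
move=> k0; have m0 : 0 <= Num.min 1 (k * `|x|) by rewrite le_min ler01 mulr_ge0.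
rewrite (ger0_norm (mulr_ge0 (sqr_ge0 x) m0)) add0r mul1r ler_piMr ?sqr_ge0//.
by rewrite ge_min lexx.
Qed.

Lemma integrable_truncated (k : R) A : measurable A -> 0 <= k ->
  mu.-integrable A (EFin \o (fun x : R => x ^+ 2 * Num.min 1 (k * `|x|))).
Proof.
move=> mA k0; apply: (integrable_le_sqr (a := 0) (b := 1)) => //.
  exact: measurable_truncated.
by move=> x; exact: normr_truncated.
Qed.

Lemma truncated_moment_ge0 (k : R) : 0 <= k -> 0 <= truncated_moment k.
Proof.
move=> k0; apply: Rintegral_ge0 => x _.
by rewrite mulr_ge0 ?sqr_ge0// le_min ler01 mulr_ge0.
Qed.

Lemma truncated_moment_le (k l : R) : 0 <= k -> k <= l ->
  truncated_moment k <= truncated_moment l.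
Proof.
move=> k0 kl; have l0 := le_trans k0 kl.
apply: le_Rintegral => //; [exact: integrable_truncated|exact: integrable_truncated|].
move=> x _; rewrite ler_wpM2l ?sqr_ge0// le_min ge_min lexx/=.
by rewrite ge_min ler_wpM2r ?orbT.
Qed.

(** Dominated convergence along [k = 1 / n.+1], with [x ^+ 2] as dominating function. *)
Lemma truncated_moment_small (e : R) : 0 < e ->
  exists2 k, 0 < k & truncated_moment k <= e.
Proof.
move=> e0; have seqcvg : truncated_moment n.+1%:R^-1 @[n --> \oo] --> (0 : R).
  have [||||_ _] := @dominated_convergence _ _ _ mu setT measurableT
      (fun n x => (x ^+ 2 * Num.min 1 (n.+1%:R^-1 * `|x|))%:E) (cst 0%E)
      (EFin \o (fun x : R => x ^+ 2)) _ _ _ int2.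
  - by move=> n; apply/measurable_EFinP; exact: measurable_truncated.
  - exact: measurable_cst.
  - apply: aeW => x _; apply: cvg_EFin; first exact: nearW.
    rewrite -(mulr0 (x ^+ 2)); apply: cvgMr.
    apply: (@squeeze_cvgr _ _ _ _ (cst 0) (fun n => n.+1%:R^-1 * `|x|)).
    + by apply: nearW => n; rewrite le_min ler01 mulr_ge0//= ge_min lexx orbT.
    + exact: cvg_cst.
    + rewrite -(mul0r `|x|); apply: cvgMl; exact: cvg_harmonic.
  - apply: aeW => x n _; rewrite /= lee_fin.
    by have := @normr_truncated n.+1%:R^-1 x; rewrite add0r mul1r; apply.
  - by rewrite integral0 => /fine_cvg.
move/cvgrPdist_le : seqcvg => /(_ _ e0)[N _ /(_ N (leqnn N))].
rewrite sub0r normrN => hN; exists N.+1%:R^-1; first by rewrite invr_gt0.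
exact: le_trans (ler_norm _) hN.
Qed.

Hypothesis mean0 : \int[mu]_x x = 0.
Hypothesis var1 : \int[mu]_x x ^+ 2 = 1.

Lemma measurable_df_affine (z k : R) : measurable_fun setT (fun x => Phi (z - k * x)).
Proof.
apply: measurableT_comp; first exact: measurable_std_normal_df.
by apply: measurable_funB => //; exact: measurable_funM.
Qed.

Lemma normr_std_normal_df_le1 (z : R) : `|Phi z| <= 1.
Proof. by rewrite ger0_norm ?std_normal_df_ge0// std_normal_df_le1. Qed.

Lemma integrable_df_affine (z k : R) A : measurable A ->
  mu.-integrable A (EFin \o (fun x => Phi (z - k * x))).
Proof.
move=> mA; apply: (@integrable_bounded_by _ _ _ _ _ 1) => //.
  exact: measurable_df_affine.
by move=> x; exact: normr_std_normal_df_le1.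
Qed.

(* Both sides agree with [Phi z - z phi z k^2 / 2] up to the stated error: the
   family [Phi (z / sqrt s)] solves the heat equation. *)
Lemma step_full (z k : R) : 0 <= k <= 1 ->
  `|\int[mu]_x Phi (z - k * x) - Phi (z / Num.sqrt (1 + k ^+ 2))| <=
    2 * (k ^+ 2 * truncated_moment k) + 3 * k ^+ 4.
Proof.
move=> /andP[k0 k1].
have kk : 0 <= k ^+ 2 <= 1 by rewrite sqr_ge0 exprn_ile1.
have scale := std_normal_scale z kk.
pose q x := Phi z - phi z * (k * x) - z * phi z * k ^+ 2 / 2 * x ^+ 2.
have iq0 : mu.-integrable setT (EFin \o (fun x => Phi z - phi z * (k * x))).
  apply: (@integrableB _ _ _ _ _ measurableT (cst (Phi z)%:E)
    (fun x => (phi z * (k * x))%:E)).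
    exact: finite_measure_integrable_cst.
  by do 2 apply: integrable_scale => //; exact: integrable_id.
have iq2 : mu.-integrable setT (EFin \o (fun x => z * phi z * k ^+ 2 / 2 * x ^+ 2)).
  exact: integrable_scale.
have iq : mu.-integrable setT (EFin \o q) by exact: (integrableB _ iq0 iq2).
have Eq : \int[mu]_x q x = Phi z - z * phi z * k ^+ 2 / 2.
  rewrite RintegralB// RintegralZl// var1 mulr1; congr (_ - _).
  rewrite RintegralB//; last 2 first.
    exact: finite_measure_integrable_cst.
    by do 2 apply: integrable_scale => //; exact: integrable_id.
  rewrite Rintegral_cst// [X in fine X]probability_setT mulr1.
  under [X in _ - X]eq_Rintegral do rewrite mulrA.
  by rewrite RintegralZl ?mean0 ?mulr0 ?subr0//; exact: integrable_id.
have idf := @integrable_df_affine z k _ measurableT.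
have -> : \int[mu]_x Phi (z - k * x) - Phi (z / Num.sqrt (1 + k ^+ 2)) =
    \int[mu]_x (Phi (z - k * x) - q x) -
    (Phi (z / Num.sqrt (1 + k ^+ 2)) - Phi z + z * phi z * k ^+ 2 / 2).
  by rewrite RintegralB// Eq; ring.
apply: (le_trans (ler_normB _ _)); rewrite lerD//; last first.
  by rewrite (exprM k 2 2).
have id : mu.-integrable setT (EFin \o (fun x => Phi (z - k * x) - q x)).
  exact: (integrableB _ idf iq).
have iT := @integrable_truncated k _ measurableT k0.
have i2T : mu.-integrable setT
    (EFin \o (fun x : R => 2 * k ^+ 2 * (x ^+ 2 * Num.min 1 (k * `|x|)))).
  exact: integrable_scale.
apply: (le_trans (le_normr_Rintegral _ id)) => //.
rewrite mulrA -RintegralZl//; apply: le_Rintegral => //.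
  exact: (integrable_norm id).
move=> x _; have := std_normal_taylor z (- (k * x)).
rewrite normrN normrM (ger0_norm k0) /q.
have -> : Phi (z - k * x) - Phi z - phi z * - (k * x) + z * phi z * (- (k * x)) ^+ 2 / 2
  = Phi (z - k * x) - (Phi z - phi z * (k * x) - z * phi z * k ^+ 2 / 2 * x ^+ 2).
  by field.
by move=> /le_trans; apply; rewrite sqrrN exprMn !mulrA.
Qed.

(** The sum of the bounds of [step_below] and [step_above], taken at the largest ratio [k] that
    occurs: the scale of one summand over the smallest Gaussian width [sigma]. It therefore serves
    all [n] replacement steps. *)
Definition step_error (sigma u : R) (n : nat) : R :=
  let k := (Num.sqrt n%:R)^-1 / sigma in
  let p := fine (mu `]u, +oo[%classic) in
  2 * (k ^+ 2 * truncated_moment k) + 3 * k ^+ 4 +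
  2 * (k * \int[mu]_(x in `]u, +oo[) `|x| + p * (4 * k ^+ 2)).

Variable u : R.
Let p : R := fine (mu `]u, +oo[%classic).

(** Exceedances are rare, so a first order comparison suffices: dropping [k * x] costs its first
    absolute moment above [u] by the Lipschitz bound, and rescaling [z] costs O(k^2) on an event of
    probability [p]. *)
Lemma step_above (z k : R) : 0 <= k <= 1 ->
  `|\int[mu]_(x in `]u, +oo[) Phi (z - k * x) -
    p * Phi (z / Num.sqrt (1 + k ^+ 2))| <=
    k * \int[mu]_(x in `]u, +oo[) `|x| + p * (4 * k ^+ 2).
Proof.
move=> /andP[k0 k1].
have kk : 0 <= k ^+ 2 <= 1 by rewrite sqr_ge0 exprn_ile1.
have mU : measurable `]u, +oo[%classic by [].
have p0 : 0 <= p by rewrite fine_ge0.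
have idf := @integrable_df_affine z k _ mU.
have ic : mu.-integrable `]u, +oo[%classic (EFin \o cst (Phi z)).
  exact: finite_measure_integrable_cst.
have -> : \int[mu]_(x in `]u, +oo[) Phi (z - k * x) -
      p * Phi (z / Num.sqrt (1 + k ^+ 2)) =
    \int[mu]_(x in `]u, +oo[) (Phi (z - k * x) - Phi z) -
    p * (Phi (z / Num.sqrt (1 + k ^+ 2)) - Phi z).
  by rewrite RintegralB// Rintegral_cst// -/p; ring.
apply: (le_trans (ler_normB _ _)); rewrite lerD//.
  have id : mu.-integrable `]u, +oo[%classic (EFin \o (fun x => Phi (z - k * x) - Phi z)).
    exact: (integrableB _ idf ic).
  apply: (le_trans (le_normr_Rintegral _ id)) => //.
  rewrite -RintegralZl//; last exact: integrable_normr.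
  apply: le_Rintegral => //; first exact: (integrable_norm id).
    by apply: integrable_scale => //; exact: integrable_normr.
  move=> x _; apply: (le_trans (std_normal_df_lipschitz _ _)).
  by rewrite addrAC subrr add0r normrN normrM (ger0_norm k0).
rewrite normrM (ger0_norm p0) ler_wpM2l//.
have scale := std_normal_scale z kk.
have -> : Phi (z / Num.sqrt (1 + k ^+ 2)) - Phi z =
  (Phi (z / Num.sqrt (1 + k ^+ 2)) - Phi z + z * phi z * k ^+ 2 / 2) -
  z * phi z * k ^+ 2 / 2 by ring.
apply: (le_trans (ler_normB _ _)).
rewrite (_ : 4 * k ^+ 2 = 3 * k ^+ 2 + k ^+ 2); last by ring.
apply: lerD.
  apply: (le_trans scale); rewrite ler_wpM2l// expr2 ler_piMr ?sqr_ge0//.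
  by case/andP : kk.
rewrite -mulrA normrM -[leRHS]mul1r ler_pM ?std_normal_pdf_id_le1//.
by rewrite ger0_norm ?divr_ge0 ?sqr_ge0// ler_pdivrMr// ler_peMr ?sqr_ge0// ler1n.
Qed.

(** Obtained as the difference of [step_full] and [step_above]. A direct expansion would meet
    truncated moments of [mu], which are not exactly 0 and 1. *)
Lemma step_below (z k : R) : 0 <= k <= 1 ->
  `|\int[mu]_(x in `]-oo, u]) Phi (z - k * x) -
    (1 - p) * Phi (z / Num.sqrt (1 + k ^+ 2))| <=
    2 * (k ^+ 2 * truncated_moment k) + 3 * k ^+ 4 +
    (k * \int[mu]_(x in `]u, +oo[) `|x| + p * (4 * k ^+ 2)).
Proof.
move=> k01; have := step_full z k01; have := step_above z k01.
have -> : \int[mu]_x Phi (z - k * x) = \int[mu]_(x in `]-oo, u]) Phi (z - k * x) +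
  \int[mu]_(x in `]u, +oo[) Phi (z - k * x).
  rewrite -Rintegral_setU//.
  - by rewrite -itv_bndbnd_setU//= set_itvE.
  - by apply: integrable_df_affine; exact: measurableU.
  - apply/disj_setPS => x [] /=; rewrite !in_itv/= andbT => xu.
    by rewrite ltNge xu.
set A := \int[mu]_(x in `]-oo, u]) _; set B := \int[mu]_(x in `]u, +oo[) Phi _.
move=> ha hf; rewrite (_ : A - _ = (A + B - Phi (z / Num.sqrt (1 + k ^+ 2))) -
   (B - p * Phi (z / Num.sqrt (1 + k ^+ 2)))); last by ring.
by apply: (le_trans (ler_normB _ _)); rewrite lerD.
Qed.

(* AM-GM: [2 c |x| <= c^2 x^2 / t + t] above [u], where moreover
   [x^2 <= M^2 + x^2 min(1, |x| / M)]. *)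
Lemma tail_first_moment_le (c t M : R) : 0 <= c -> 0 < t -> 0 < M ->
  c * \int[mu]_(x in `]u, +oo[) `|x| <=
  (c ^+ 2 * (M ^+ 2 * p + truncated_moment M^-1) / t + t * p) / 2.
Proof.
move=> c0 t0 M0; have mU : measurable `]u, +oo[%classic by [].
have M1 : 0 <= M^-1 by rewrite invr_ge0 ltW.
pose g (x : R) := c ^+ 2 / (2 * t) * (M ^+ 2 + x ^+ 2 * Num.min 1 (M^-1 * `|x|)) + t / 2.
have it := @integrable_truncated M^-1 _ mU M1.
have ig1 : mu.-integrable `]u, +oo[%classic
    (EFin \o (fun x => M ^+ 2 + x ^+ 2 * Num.min 1 (M^-1 * `|x|))).
  by apply: integrable_add => //; exact: finite_measure_integrable_cst.
have ig2 : mu.-integrable `]u, +oo[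
    (EFin \o (fun x => c ^+ 2 / (2 * t) * (M ^+ 2 + x ^+ 2 * Num.min 1 (M^-1 * `|x|)))).
  exact: integrable_scale.
have ict : mu.-integrable `]u, +oo[%classic (EFin \o cst (t / 2)).
  exact: finite_measure_integrable_cst.
have ig : mu.-integrable `]u, +oo[%classic (EFin \o g) by exact: (integrableD mU ig2 ict).
rewrite -RintegralZl//; last exact: integrable_normr.
apply: (@le_trans _ _ (\int[mu]_(x in `]u, +oo[) g x)).
  apply: le_Rintegral => //.
    by apply: integrable_scale => //; exact: integrable_normr.
  move=> x _; rewrite /g.
  have h1 : x ^+ 2 <= M ^+ 2 + x ^+ 2 * Num.min 1 (M^-1 * `|x|).
    have [xM|xM] := leP 1 (M^-1 * `|x|); first by rewrite mulr1 lerDr sqr_ge0.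
    have xM' : `|x| <= M by move: xM; rewrite mulrC ltr_pdivrMr// mul1r => /ltW.
    apply: (@le_trans _ _ (M ^+ 2)).
      by rewrite -(real_normK (num_real x)) lerXn2r ?nnegrE// ltW.
    by rewrite lerDl mulr_ge0 ?sqr_ge0// mulr_ge0.
  apply: (@le_trans _ _ (c ^+ 2 / (2 * t) * x ^+ 2 + t / 2)); last first.
    by rewrite lerD2r ler_wpM2l// divr_ge0 ?sqr_ge0// mulr_ge0// ltW.
  rewrite -(real_normK (num_real x)).
  have -> : c ^+ 2 / (2 * t) * `|x| ^+ 2 + t / 2 =
      (c ^+ 2 * `|x| ^+ 2 + t ^+ 2) / (2 * t).
    by field; rewrite gt_eqF.
  rewrite ler_pdivlMr ?mulr_gt0//.
  by have := sqr_ge0 (c * `|x| - t); nra.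
rewrite RintegralD// RintegralZl// RintegralD//; last first.
  exact: finite_measure_integrable_cst.
rewrite !Rintegral_cst// -/p.
have trunc_le : \int[mu]_(x in `]u, +oo[) (x ^+ 2 * Num.min 1 (M^-1 * `|x|)) <=
    truncated_moment M^-1.
  rewrite /truncated_moment [leRHS](_ : _ =
      \int[mu]_(x in `]-oo, u]%classic `|` `]u, +oo[%classic)
        (x ^+ 2 * Num.min 1 (M^-1 * `|x|))).
    rewrite Rintegral_setU//.
    - rewrite lerDr; apply: Rintegral_ge0 => x _.
      by rewrite mulr_ge0 ?sqr_ge0// le_min ler01 mulr_ge0.
    - by apply: integrable_truncated => //; exact: measurableU.
    - apply/disj_setPS => x [] /=; rewrite !in_itv/= andbT => xu.
      by rewrite ltNge xu.
  by congr Rintegral; rewrite -itv_bndbnd_setU//= set_itvE.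
have ct0 : 0 <= c ^+ 2 / (2 * t) by rewrite divr_ge0 ?sqr_ge0// mulr_ge0// ltW.
rewrite [leRHS](_ : _ =
    c ^+ 2 / (2 * t) * (M ^+ 2 * p + truncated_moment M^-1) + t / 2 * p).
  by rewrite lerD2r ler_wpM2l// lerD2l.
by field; rewrite gt_eqF.
Qed.

End OneStep.

Lemma near_inv_sqrt_le (R : realType) (r : R) : 0 < r ->
  \forall n \near \oo, (Num.sqrt (n%:R : R))^-1 <= r.
Proof.
move=> r0; near=> n.
have ri : 0 < r^-1 by rewrite invr_gt0.
have nr : (r^-1) ^+ 2 <= n%:R by near: n; exact: nbhs_infty_ger.
have rn : r^-1 <= Num.sqrt n%:R.
  by rewrite -(ger0_norm (ltW ri)) -sqrtr_sqr ler_wsqrtr.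
by rewrite -[leRHS]invrK lef_pV2 ?posrE// (lt_le_trans ri).
Unshelve. all: by end_near. Qed.

(** Since [n * k ^+ 2] is the constant [A = sigma ^- 2] and [p n] is O(1/n), every term except the
    tail first moment is visibly o(1) after multiplication by [n]; that one is handled by
    [tail_first_moment_le]. *)
Lemma step_error_cvg0 (R : realType) (mu : probability R R) (sigma tau : R)
    (u : nat -> R) :
  mu.-integrable setT (EFin \o (fun x : R => x ^+ 2)) -> 0 < sigma ->
  n%:R * fine (mu `]u n, +oo[%classic) @[n --> \oo] --> tau ->
  n%:R * step_error mu sigma (u n) n @[n --> \oo] --> (0 : R).
Proof.
move=> int2 s0; set p := fun n => fine (mu `]u n, +oo[%classic) => np.
have p0 n : 0 <= p n by rewrite /p fine_ge0.
pose A := sigma ^- 2; have A0 : 0 < A by rewrite invr_gt0 exprn_gt0.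
have [C C0 hC] : exists2 C : R, 0 < C & \forall n \near \oo, n%:R * p n <= C.
  exists (`|tau| + 1); first by rewrite ltr_pwDr.
  near=> n.
  have : `|tau - n%:R * p n| <= 1 by near: n; move/cvgrPdist_le : np; apply.
  by rewrite ler_norml => /andP[+ _]; have := ler_norm tau; lra.
have p_small r : 0 < r -> \forall n \near \oo, p n <= r.
  move=> r0; near=> n.
  have n0 : (0 : R) < n%:R by near: n; exact: nbhs_infty_gtr.
  have h1 : n%:R * p n <= C by near: n.
  have h2 : C / r <= n%:R by near: n; exact: nbhs_infty_ger.
  rewrite -(ler_pM2l n0); apply: (le_trans h1).
  by rewrite -ler_pdivrMr.
apply/cvgrPdist_le => e e0.
(* Six terms get [e / 6] each. In the tail bound the order of choices matters: [t] makes
   [t * (n * p n)] small, then [M] makes the truncated moment small relative to [t], and only then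
   is [n] taken large enough for the term with [M ^+ 2]. *)
pose t := e / (6 * C); have t0 : 0 < t by rewrite divr_gt0// mulr_gt0.
have e6 : 0 < e / 6 by rewrite divr_gt0.
have [k1 k10 hk1] := truncated_moment_small int2 (divr_gt0 e6 (mulr_gt0 (ltr0Sn _ 1) A0)).
have [k2 k20 hk2] := truncated_moment_small int2 (divr_gt0 (mulr_gt0 e6 t0) A0).
pose M := k2^-1; have M0 : 0 < M by rewrite invr_gt0.
have c0 : 0 < A * M ^+ 2 / t by rewrite divr_gt0// mulr_gt0// exprn_gt0.
have r0 : 0 < (A * M ^+ 2 / t)^-1 * (e / 6) by rewrite mulr_gt0 ?invr_gt0.
near=> n; rewrite sub0r normrN.
have n0 : (0 : R) < n%:R by near: n; exact: nbhs_infty_gtr.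
have sn0 : 0 < Num.sqrt (n%:R : R) by rewrite sqrtr_gt0.
set k := (Num.sqrt (n%:R : R))^-1 / sigma.
have k0 : 0 <= k by rewrite divr_ge0 ?invr_ge0 ?ltW.
have nk : n%:R * k ^+ 2 = A.
  rewrite /k /A expr_div_n exprVn sqr_sqrtr ?ler0n//; field.
  by rewrite !gt_eqF.
have kk1 : k <= k1.
  rewrite ler_pdivrMr//; near: n; apply: near_inv_sqrt_le.
  exact: mulr_gt0.
have Tk : 2 * A * truncated_moment mu k <= e / 6.
  rewrite -ler_pdivlMl ?mulr_gt0// mulrC.
  exact: le_trans (truncated_moment_le int2 k0 kk1) hk1.
have An : 3 * A ^+ 2 / n%:R <= e / 6.
  rewrite ler_pdivrMr// -ler_pdivrMl//; near: n; exact: nbhs_infty_ger.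
have p1 : 8 * A * p n <= e / 6.
  rewrite -ler_pdivlMl ?mulr_gt0//; near: n; apply: p_small.
  by rewrite mulr_gt0// invr_gt0 mulr_gt0.
have p2 : A * M ^+ 2 / t * p n <= e / 6.
  by rewrite -ler_pdivlMl//; near: n; exact: p_small.
have p3 : t * (n%:R * p n) <= e / 6.
  have -> : e / 6 = t * C by rewrite /t; field; rewrite gt_eqF.
  by rewrite ler_pM2l//; near: n.
have TM : A * truncated_moment mu M^-1 / t <= e / 6.
  rewrite /M invrK ler_pdivrMr// mulrC -ler_pdivlMr//.
have tail := tail_first_moment_le int2 (u n) k0 t0 M0.
have k4 : n%:R * k ^+ 4 = A ^+ 2 / n%:R.
  by rewrite (exprM k 2 2) -nk; field; rewrite gt_eqF.
have E : n%:R * step_error mu sigma (u n) n = 2 * A * truncated_moment mu k +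
   3 * A ^+ 2 / n%:R + 2 * (n%:R * (k * \int[mu]_(x in `]u n, +oo[) `|x|)) +
   8 * A * p n.
  rewrite /step_error -/k -/(p n).
  rewrite -[3 * A ^+ 2 / _]mulrA -k4 -nk; ring.
have T0 := truncated_moment_ge0 mu k0.
have I0 : 0 <= \int[mu]_(x in `]u n, +oo[) `|x| by exact: Rintegral_ge0.
rewrite E ger0_norm; last first.
  rewrite !addr_ge0//.
  - by rewrite mulr_ge0// mulr_ge0// ltW.
  - by rewrite divr_ge0// mulr_ge0// sqr_ge0.
  - by rewrite mulr_ge0// mulr_ge0// mulr_ge0.
  - by rewrite mulr_ge0// mulr_ge0// ltW.
have tail' : 2 * (n%:R * (k * \int[mu]_(x in `]u n, +oo[) `|x|)) <=
    A * M ^+ 2 / t * p n + A * truncated_moment mu M^-1 / t + t * (n%:R * p n).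
  apply: (@le_trans _ _ (2 * (n%:R *
      ((k ^+ 2 * (M ^+ 2 * p n + truncated_moment mu M^-1) / t + t * p n) / 2)))).
    by rewrite ler_pM2l// ler_pM2l.
  rewrite le_eqVlt -nk; apply/orP; left; apply/eqP; field.
  by rewrite gt_eqF.
lra.
Unshelve. all: by end_near. Qed.

(** * Hybrid argument *)

(** As functions of [C] both sides are finite measures, a restricted and a rescaled image of [P].
    They agree on rectangles, a class stable under intersection that generates the product
    sigma-algebra, hence everywhere. *)
Lemma rectangle_independence d d1 d2 (T : measurableType d)
    (T1 : measurableType d1) (T2 : measurableType d2) (R : realType)
    (P : probability T R) (h : T -> T1 * T2) (E : set T) :
  measurable_fun setT h -> measurable E ->
  (forall A B, measurable A -> measurable B ->
     P (h @^-1` (A `*` B) `&` E) = (P (h @^-1` (A `*` B)) * P E)%E) ->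
  forall C, measurable C -> P (h @^-1` C `&` E) = (P (h @^-1` C) * P E)%E.
Proof.
move=> mh mE rect C mC.
have PE0 : 0 <= fine (P E) by rewrite fine_ge0.
pose r := NngNum PE0.
have PEr : P E = (r%:num)%:E by rewrite /= fineK// fin_num_measure.
have -> : (P (h @^-1` C) * P E)%E = mscale r (pushforward P h) C.
  by rewrite /mscale muleC PEr.
have -> : P (h @^-1` C `&` E) = pushforward (mrestr P mE) h C by [].
pose G : set (set (T1 * T2)) := [set C | exists A, measurable A /\
   exists B, measurable B /\ C = A `*` B].
apply: (measure_unique G (fun=> setT)) => //.
- rewrite measurable_prod_measurableType //; congr (<<s _ >>).
  rewrite predeqE; split => [[A mA [B mB <-]]|[A [mA [B [mB ->]]]]].
    by exists A; split => //; exists B.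
  by exists A => //; exists B.
- move=> /= _ _ [X1 [mX1 [X2 [mX2 ->]]]] [Y1 [mY1 [Y2 [mY2 ->]]]].
  rewrite -setXI; exists (X1 `&` Y1); split; first exact: measurableI.
  by exists (X2 `&` Y2); split => //; exact: measurableI.
- by move=> _; exists setT; split => //; exists setT; split => //; rewrite setXTT.
- by rewrite bigcup_const.
- move=> _ [A [mA [B [mB ->]]]].
  by rewrite /= /pushforward /mrestr /mscale rect// muleC PEr.
- move=> _; rewrite /= /pushforward /mrestr preimage_setT setTI.
  by rewrite (le_lt_trans (probability_le1 _ _))// ltry.
Qed.

Section StateProcess.
Context d (T : measurableType d) (R : realType) (P : probability T R).
Variable X : nat -> {RV P >-> R}.
Hypothesis hindep : mutually_independent X.
Hypothesis hid : forall i A, measurable A -> P (X i @^-1` A) = P (X 0%N @^-1` A).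
Context dE (E : measurableType dE).
Variables (psi : E * R -> E) (e0 : E).
Hypothesis mpsi : measurable_fun setT psi.

Fixpoint state (m : nat) (w : T) : E :=
  if m is m'.+1 then psi (state m' w, X m' w) else e0.

Lemma measurable_state m : measurable_fun setT (state m).
Proof.
elim: m => [|m IH]; first exact: measurable_cst.
by apply: measurableT_comp => //; exact: measurable_fun_pair.
Qed.

HB.instance Definition _ m :=
  isMeasurableFun.Build _ _ _ _ (state m) (measurable_state m).

Let Xin (I : {fset nat}) (A : nat -> set R) := \bigcap_(i in [set` I]) (X i @^-1` A i).

Let measurable_Xin I A : (forall i, measurable (A i)) -> measurable (Xin I A).
Proof.
move=> mA; apply: fin_bigcap_measurable; first exact: finite_fset.
by move=> i _; rewrite -[X in measurable X]setTI; exact: measurable_funPT.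
Qed.

(** Induction on [m]. The next state is a function of [(state m, X m)], so rectangles [B] times [C]
    are enough; on these the event that [X m] lies in [C] joins the events of later variables, as
    the index [m] of the family [A'], and the induction hypothesis applies. *)
Lemma state_independent m (I : {fset nat}) (A : nat -> set R) (D : set E) :
  (forall i, i \in I -> (m <= i)%N) -> (forall i, measurable (A i)) ->
  measurable D ->
  P (state m @^-1` D `&` Xin I A) = (P (state m @^-1` D) * P (Xin I A))%E.
Proof.
elim: m I A D => [|m IH] I A D hI mA mD.
  rewrite preimage_cst; case: ifP => _.
    by rewrite setTI probability_setT mul1e.
  by rewrite set0I measure0 mul0e.
pose h w := (state m w, X m w).
have mh : measurable_fun setT h.
  by apply: measurable_fun_pair => //; exact: measurable_state.
have mpsiD : measurable (psi @^-1` D) by rewrite -[X in measurable X]setTI; exact: mpsi.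
apply: (@rectangle_independence _ _ _ _ _ _ _ P h (Xin I A) mh _ _ _ mpsiD).
  exact: measurable_Xin.
move=> B C mB mC.
have mI : m \notin I by apply/negP => /hI; rewrite ltnn.
have -> : h @^-1` (B `*` C) = state m @^-1` B `&` X m @^-1` C by [].
have IH1 : P (state m @^-1` B `&` X m @^-1` C) =
    (P (state m @^-1` B) * P (X m @^-1` C))%E.
  have := IH [fset m]%fset (fun=> C) B.
  rewrite /Xin (_ : [set` [fset m]%fset] = [set m]); last first.
    by apply/seteqP; split => x /=; rewrite inE => /eqP.
  by rewrite bigcap_set1; apply => // i; rewrite inE => /eqP ->.
pose A' i := if i == m then C else A i.
have mA' i : measurable (A' i) by rewrite /A'; case: ifP.
have XI : Xin (m |` I)%fset A' = X m @^-1` C `&` Xin I A.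
  rewrite /Xin; apply/seteqP; split => w /=.
    move=> H; split; first by have := H m; rewrite /= /A' eqxx; apply; rewrite !inE eqxx.
    move=> i /= iI; have := H i; rewrite /= /A'.
    case: eqP => [im|_]; first by move: iI mI; rewrite im => ->.
    by apply; rewrite !inE iI orbT.
  move=> [Hm HI] i /=; rewrite !inE => /orP[/eqP ->|iI]; first by rewrite /A' eqxx.
  rewrite /A'; case: eqP => [im|_]; first by move: iI mI; rewrite im => ->.
  exact: HI.
have PXI : P (X m @^-1` C `&` Xin I A) = (P (X m @^-1` C) * P (Xin I A))%E.
  rewrite -XI (hindep _ mA') big_fsetU1//= {1}/A' eqxx; congr (_ * _)%E.
  rewrite (hindep _ mA); apply: eq_big_seq => i iI; rewrite /A'.
  by case: eqP => // im; move: iI mI; rewrite im => ->.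
rewrite -setIA -XI IH//.
  by rewrite XI PXI IH1 muleA.
by move=> i; rewrite !inE => /orP[/eqP ->//|/hI/ltnW].
Qed.

Lemma state_next_law m C : measurable C ->
  P ((fun w => (state m w, X m w)) @^-1` C) =
  (distribution P (state m) \x distribution P (X 0%N))%E C.
Proof.
move=> mC; set h := fun w => _.
have mh : measurable_fun setT h.
  by apply: measurable_fun_pair => //; exact: measurable_state.
have -> : P (h @^-1` C) = pushforward P h C by [].
apply/esym; apply: product_measure_unique => // B D mB mD.
rewrite /= /pushforward.
have -> : h @^-1` (B `*` D) = state m @^-1` B `&` X m @^-1` D by [].
have := @state_independent m [fset m]%fset (fun=> D) B.
rewrite /Xin (_ : [set` [fset m]%fset] = [set m]); last first.
  by apply/seteqP; split => x /=; rewrite inE => /eqP.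
rewrite bigcap_set1 => ->//; first by rewrite (hid _ mD).
by move=> i; rewrite inE => /eqP ->.
Qed.

(** The Markov property in integrated form: by Tonelli on the product law, the next sample is
    integrated out with the current state frozen. *)
Lemma integral_state_next m (f : E * R -> \bar R) :
  measurable_fun setT f -> (forall z, (0 <= f z)%E) ->
  (\int[P]_w f (state m w, X m w) =
   \int[P]_w \int[distribution P (X 0%N)]_x f (state m w, x))%E.
Proof.
move=> mf f0; pose h w := (state m w, X m w).
have mh : measurable_fun setT h.
  by apply: measurable_fun_pair => //; exact: measurable_state.
have := @ge0_integral_pushforward _ _ _ _ _ _ mh P setT f measurableT.
rewrite preimage_setT => <-//.
rewrite (_ : (\int[pushforward P h]_y f y)%E =
  (\int[distribution P (state m) \x distribution P (X 0%N)]_y f y)%E); last first.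
  apply: eq_measure_integral => A mA _.
  exact: state_next_law.
rewrite fubini_tonelli1// ge0_integral_distribution//.
  exact: measurable_fun_fubini_tonelli_F.
by move=> y; exact: integral_ge0.
Qed.

End StateProcess.

(* [binomial_lt p m k] is the probability that a binomial(m, p) variable is
   smaller than k, in the form of the recursion obtained by conditioning on the
   last trial. *)
Fixpoint binomial_lt (R : realType) (p : R) (m k : nat) : R :=
  match k, m with
  | 0%N, _ => 0
  | _.+1, 0%N => 1
  | k'.+1, m'.+1 => (1 - p) * binomial_lt p m' k'.+1 + p * binomial_lt p m' k'
  end.

Section Hybrid.
Context d (T : measurableType d) (R : realType) (P : probability T R).
Variable X : nat -> {RV P >-> R}.
Hypothesis hindep : mutually_independent X.
Hypothesis hid : forall i A, measurable A -> P (X i @^-1` A) = P (X 0%N @^-1` A).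
Local Notation mu := (distribution P (X 0%N)).
Variable u : R.
Let p : R := fine (mu `]u, +oo[%classic).

(** The number of exceedances is kept as a real number, so that the chain lives in [R * R] and both
    components have the same measurability arguments. *)
Definition count_sum_step (z : (R * R) * R) : R * R :=
  (z.1.1 + \1_(`]u, +oo[%classic) z.2, z.1.2 + z.2).

Lemma measurable_count_sum_step : measurable_fun setT count_sum_step.
Proof.
apply: measurable_fun_pair; apply: measurable_funD => //.
- by apply: measurableT_comp => //; exact: measurableT_comp.
- by apply: measurableT_comp => //; exact: measurable_indic.
- by apply: measurableT_comp => //; exact: measurableT_comp.
Qed.

Local Notation st := (state X count_sum_step (0, 0)).

Lemma state_count_sum m w :
  st m w = (\sum_(i < m) \1_(`]u, +oo[%classic) (X i w), \sum_(i < m) X i w).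
Proof.
elim: m => [|m IH]; first by rewrite !big_ord0.
by rewrite [LHS]/= IH /count_sum_step/= !big_ord_recr.
Qed.

(** In usual notation E(W(S_m); N_m < k), where N_m counts the exceedances of [u]. The strict
    inequality gives 0 at [k = 0], in agreement with [binomial_lt]. *)
Definition weighted_mean (W : R -> R) (m k : nat) : R :=
  \int[P]_w (\1_(`]-oo, k%:R[%classic) (st m w).1 * W (st m w).2).

Definition lower_step (W : R -> R) (s : R) : R :=
  \int[mu]_(x in `]-oo, u]) W (s + x).
Definition upper_step (W : R -> R) (s : R) : R :=
  \int[mu]_(x in `]u, +oo[) W (s + x).

Lemma weighted_mean0r (W : R -> R) m : weighted_mean W m 0 = 0.
Proof.
rewrite /weighted_mean; transitivity (\int[P]_(w in setT) (0 : R)); last first.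
  by rewrite Rintegral_cst// mul0r.
apply: eq_Rintegral => w _; rewrite indicE memNset ?mul0r//= in_itv/=.
apply/negP; rewrite -leNgt state_count_sum/=; apply: sumr_ge0 => i _.
by rewrite indicE.
Qed.

Lemma weighted_mean0l (W : R -> R) k : weighted_mean W 0 k.+1 = W 0.
Proof.
rewrite /weighted_mean/=; under eq_Rintegral.
  move=> w _; rewrite indicE mem_set/= ?in_itv/= ?ltr0Sn// mul1r; over.
by rewrite Rintegral_cst// [X in fine X]probability_setT mulr1.
Qed.

Lemma integrable_unit (d' : measure_display) (U : measurableType d') (m : probability U R)
    (f : U -> R) (A : set U) : measurable A -> measurable_fun setT f ->
  (forall x, 0 <= f x <= 1) -> m.-integrable A (EFin \o f).
Proof.
move=> mA mf f01; apply: (@integrable_bounded_by _ _ _ _ _ 1) => // x.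
by have /andP[f0 f1] := f01 x; rewrite ger0_norm.
Qed.

Section Step.
Variable W : R -> R.
Hypothesis mW : measurable_fun setT W.
Hypothesis W01 : forall s, 0 <= W s <= 1.

Let integrable_shift s A : measurable A ->
  mu.-integrable A (EFin \o (fun x => W (s + x))).
Proof.
move=> mA; apply: integrable_unit => //.
by apply: measurableT_comp => //; exact: measurable_funD.
Qed.

Let step_weight (k : nat) (z : (R * R) * R) : R :=
  \1_(`]-oo, k.+1%:R[%classic) (count_sum_step z).1 * W (count_sum_step z).2.

Let measurable_step_weight k : measurable_fun setT (step_weight k).
Proof.
apply: measurable_funM.
- apply: measurableT_comp; first exact: measurable_indic.
  by apply: measurableT_comp => //; exact: measurable_count_sum_step.
- apply: measurableT_comp => //.
  by apply: measurableT_comp => //; exact: measurable_count_sum_step.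
Qed.

Let step_weight01 k z : 0 <= step_weight k z <= 1.
Proof.
rewrite /step_weight indicE; case: (_ \in _); rewrite ?mul1r ?mul0r ?W01//.
by rewrite lexx ler01.
Qed.

(** Below [u] the count does not change; above [u] it grows by one, and then being smaller than
    [k.+1] means having been smaller than [k] before. *)
Let step_weight_integral k (v : R * R) :
  (\int[mu]_x (step_weight k (v, x))%:E =
  (\1_(`]-oo, k.+1%:R[%classic) v.1 * lower_step W v.2 +
   \1_(`]-oo, k%:R[%classic) v.1 * upper_step W v.2)%:E)%E.
Proof.
have int A : measurable A -> mu.-integrable A (EFin \o (fun x => step_weight k (v, x))).
  move=> mA; apply: integrable_unit => //.
  by apply: measurableT_comp => //; exact: measurable_fun_pair.
have mI : measurable (`]-oo, u]%classic `|` `]u, +oo[%classic : set R).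
  exact: measurableU.
rewrite -[LHS]fineK; last by apply: integrable_fin_num => //; exact: int.
congr EFin; rewrite -/(Rintegral mu setT _).
rewrite (_ : [set: R] = `]-oo, u]%classic `|` `]u, +oo[%classic); last first.
  by rewrite -itv_bndbnd_setU//= set_itvE.
rewrite Rintegral_setU//; last 2 first.
- exact: int.
- apply/disj_setPS => x [] /=; rewrite !in_itv/= andbT => xu.
  by rewrite ltNge xu.
rewrite /lower_step /upper_step -!RintegralZl//; last 2 first.
  exact: integrable_shift.
  exact: integrable_shift.
congr (_ + _); apply: eq_Rintegral => x; rewrite inE/= in_itv/= => xu.
- rewrite /step_weight/= (_ : \1_(`]u, +oo[%classic) x = 0) ?addr0//.
  by rewrite indicE memNset//= in_itv/= andbT; apply/negP; rewrite -leNgt.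
- rewrite /step_weight/= (_ : \1_(`]u, +oo[%classic) x = 1); last first.
    by rewrite indicE mem_set//= in_itv/= xu.
  congr (_ * _); rewrite !indicE; congr ((nat_of_bool _)%:R).
  by apply/idP/idP; rewrite !inE/= !in_itv/= -natr1 ltrD2r.
Qed.

Lemma weighted_meanS m k : weighted_mean W m.+1 k.+1 =
  \int[P]_w (\1_(`]-oo, k.+1%:R[%classic) (st m w).1 * lower_step W (st m w).2 +
   \1_(`]-oo, k%:R[%classic) (st m w).1 * upper_step W (st m w).2).
Proof.
rewrite /weighted_mean {1}/Rintegral.
have := @integral_state_next _ _ _ _ _ hindep hid _ _ count_sum_step (0, 0)
  measurable_count_sum_step m (EFin \o step_weight k).
move=> -> //; last 2 first.
- by apply/measurable_EFinP; exact: measurable_step_weight.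
- by move=> z; rewrite lee_fin; case/andP: (step_weight01 k z).
by congr fine; apply: eq_integral => w _; rewrite step_weight_integral.
Qed.

Let step_mean k (v : R * R) : R :=
  \1_(`]-oo, k.+1%:R[%classic) v.1 * lower_step W v.2 +
  \1_(`]-oo, k%:R[%classic) v.1 * upper_step W v.2.

Let step_meanE k v : (step_mean k v)%:E = (\int[mu]_x (step_weight k (v, x))%:E)%E.
Proof. by rewrite step_weight_integral. Qed.

(** Measurability comes from Tonelli's theorem, because the function is a partial integral of
    [step_weight]. *)
Lemma measurable_step_mean k : measurable_fun setT (step_mean k).
Proof.
apply/measurable_EFinP; rewrite (_ : _ \o _ = fubini_F mu (EFin \o step_weight k)).
  apply: measurable_fun_fubini_tonelli_F.
    by apply/measurable_EFinP; exact: measurable_step_weight.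
  by move=> z; rewrite lee_fin; case/andP: (step_weight01 k z).
by apply/funext => v; rewrite /= step_meanE.
Qed.

Lemma step_mean01 k v : 0 <= step_mean k v <= 1.
Proof.
have mk : measurable_fun setT (fun x => (step_weight k (v, x))%:E).
  apply/measurable_EFinP; apply: measurableT_comp; first exact: measurable_step_weight.
  exact: measurable_fun_pair.
rewrite -!lee_fin step_meanE integral_ge0//=; last first.
  by move=> x _; rewrite lee_fin; case/andP: (step_weight01 k (v, x)).
apply: (@le_trans _ _ (\int[mu]_x (cst 1%E x))%E).
  apply: ge0_le_integral => //.
  - by move=> x _; rewrite lee_fin; case/andP: (step_weight01 k (v, x)).
  - by move=> x _; rewrite lee_fin; case/andP: (step_weight01 k (v, x)).
by rewrite integral_cst// [X in (_ * X)%E]probability_setT mule1.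
Qed.

Lemma measurable_state_fst m : measurable_fun setT (fun w => (st m w).1).
Proof.
by apply: measurableT_comp => //; exact: (measurable_state _ _ measurable_count_sum_step).
Qed.

Lemma measurable_state_snd m : measurable_fun setT (fun w => (st m w).2).
Proof.
by apply: measurableT_comp => //; exact: (measurable_state _ _ measurable_count_sum_step).
Qed.

Lemma integrable_step_mean m k :
  P.-integrable setT (EFin \o (fun w => step_mean k (st m w))).
Proof.
apply: integrable_unit => //; last by move=> w; exact: step_mean01.
apply: measurableT_comp; first exact: measurable_step_mean.
exact: (measurable_state _ _ measurable_count_sum_step).
Qed.

Lemma integrable_weighted m k :
  P.-integrable setT
    (EFin \o (fun w => \1_(`]-oo, k%:R[%classic) (st m w).1 * W (st m w).2)).
Proof.
apply: integrable_unit => //.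
  apply: measurable_funM.
  - apply: measurableT_comp; [exact: measurable_indic|exact: measurable_state_fst].
  - by apply: measurableT_comp => //; exact: measurable_state_snd.
move=> w; rewrite indicE; case: (_ \in _); rewrite ?mul1r ?mul0r ?W01//.
by rewrite lexx ler01.
Qed.

End Step.

(** Conditioning on the first [m] samples leaves the two one-step errors, each multiplied by an
    indicator, so the pointwise bound [dl] passes to the mean. *)
Lemma hybrid_step (W W' : R -> R) (dl : R) m k :
  measurable_fun setT W -> (forall s, 0 <= W s <= 1) ->
  measurable_fun setT W' -> (forall s, 0 <= W' s <= 1) ->
  (forall s, `|lower_step W' s - (1 - p) * W s| +
    `|upper_step W' s - p * W s| <= dl) ->
  `|weighted_mean W' m.+1 k.+1 -
    ((1 - p) * weighted_mean W m k.+1 + p * weighted_mean W m k)| <= dl.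
Proof.
move=> mW W01 mW' W01' hdl.
have i1 := integrable_weighted mW W01 m k.+1.
have i2 := integrable_weighted mW W01 m k.
have i3 := integrable_step_mean mW' W01' m k.
have j1 := integrable_scale (1 - p) measurableT i1.
have j2 := integrable_scale p measurableT i2.
have j12 := integrable_add measurableT j1 j2.
rewrite (weighted_meanS mW' W01') /weighted_mean -!RintegralZl// -RintegralD//.
rewrite -RintegralB//.
have j := integrableB measurableT i3 j12.
apply: (le_trans (le_normr_Rintegral _ j)) => //.
apply: (@le_trans _ _ (\int[P]_(w in setT) dl)); last first.
  by rewrite Rintegral_cst// [X in fine X]probability_setT mulr1.
apply: le_Rintegral => //; first exact: (integrable_norm j).
  exact: finite_measure_integrable_cst.
move=> w _; apply: le_trans (hdl (st m w).2).
set a := \1_ _ _; set b := \1_ _ _; set L := lower_step _ _; set U := upper_step _ _.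
set V := W _.
have -> : a * L + b * U - ((1 - p) * (a * V) + p * (b * V)) =
  a * (L - (1 - p) * V) + b * (U - p * V) by ring.
have ind_le (A : set R) (x t : R) : `|\1_A x * t| <= `|t|.
  by rewrite indicE; case: (_ \in _); rewrite ?mul1r ?mul0r ?normr0.
by apply: (le_trans (ler_normD _ _)); apply: lerD; exact: ind_le.
Qed.

Lemma prob_upper01 : 0 <= p <= 1.
Proof.
by rewrite /p fine_ge0//= -lee_fin fineK ?fin_num_measure// probability_le1.
Qed.

(** The means follow the recursion of [binomial_lt] up to [dl] per step. The weights [1 - p] and [p]
    are convex, so errors add up without being amplified. Letting the test function vary with [m] is
    what encodes the successive Gaussian replacements. *)
Lemma hybrid (W : nat -> R -> R) (dl : R) (n : nat) :
  (forall m, measurable_fun setT (W m)) -> (forall m s, 0 <= W m s <= 1) ->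
  (forall m s, (m < n)%N ->
   `|lower_step (W m.+1) s - (1 - p) * W m s| +
   `|upper_step (W m.+1) s - p * W m s| <= dl) ->
  forall m k, (m <= n)%N ->
  `|weighted_mean (W m) m k - binomial_lt p m k * W 0%N 0| <= m%:R * dl.
Proof.
move=> mW W01 hdl; elim=> [|m IH] [|k] mn.
- by rewrite weighted_mean0r mul0r subrr normr0 mul0r.
- by rewrite weighted_mean0l mul1r subrr normr0 mul0r.
- have dl0 : 0 <= dl by apply: le_trans (hdl m 0 mn); rewrite addr_ge0.
  by rewrite weighted_mean0r mul0r subrr normr0 mulr_ge0.
have /andP[p0 p1] := prob_upper01.
have hs := hybrid_step m k (mW m) (W01 m) (mW m.+1) (W01 m.+1) (fun s => hdl m s mn).
have h1 := IH k.+1 (ltnW mn); have h2 := IH k (ltnW mn).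
set a := weighted_mean _ _ _ in hs *; set b := weighted_mean _ _ _ in hs h1.
set c := weighted_mean _ _ _ in hs h2.
rewrite /= -/binomial_lt; set B1 := binomial_lt p m k.+1 in h1 *.
set B2 := binomial_lt p m k in h2 *; set V := W 0%N 0 in h1 h2 *.
have -> : a - ((1 - p) * B1 + p * B2) * V = (a - ((1 - p) * b + p * c)) +
   ((1 - p) * (b - B1 * V) + p * (c - B2 * V)) by ring.
have -> : m.+1%:R * dl = dl + m%:R * dl by rewrite -natr1; ring.
apply: (le_trans (ler_normD _ _)); rewrite lerD//.
apply: (le_trans (ler_normD _ _)).
rewrite !normrM (ger0_norm p0) ger0_norm ?subr_ge0//.
have -> : m%:R * dl = (1 - p) * (m%:R * dl) + p * (m%:R * dl) by ring.
by rewrite lerD// ler_wpM2l// subr_ge0.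
Qed.

End Hybrid.

(** * Poisson limit *)

Lemma cvg_invn (R : realType) : (n%:R^-1 : R) @[n --> \oo] --> (0 : R).
Proof. by rewrite -cvg_shiftS; exact: cvg_harmonic. Qed.

Section Poisson.
Variable R : realType.
Implicit Types (p : R) (g tau : R).

Lemma binomial_ltE p m k : binomial_lt p m k =
  \sum_(i < k) 'C(m, i)%:R * p ^+ i * (1 - p) ^+ (m - i).
Proof.
elim: m k => [|m IH] [|k]; rewrite ?big_ord0//.
  rewrite big_ord_recl/= big1 ?addr0 ?mulr1// => i _.
  by rewrite bin0n/= !mul0r.
rewrite /= !{}IH big_ord_recl [RHS]big_ord_recl /= !bin0 !subn0 !expr0 !mul1r.
rewrite mulrDr -exprS -addrA; congr (_ + _).
rewrite !mulr_sumr -big_split/=; apply: eq_bigr => i _.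
rewrite /bump/= !add1n subSS binS natrD.
(* Pascal's rule combines the two terms. For [m <= i] the truncated exponents do not match, but
   there ['C(m, i.+1)] vanishes. *)
have [mi|im] := leqP m i.
  by rewrite (@bin_small m i.+1)// exprS; ring.
by rewrite -(subnSK im) !exprS; ring.
Qed.

(** Term by term: the term of index 0 tends to [g] by hypothesis, and the ratio of the terms of
    index [i.+1] and [i] is [(n - i) p / (i.+1 (1 - p))], which tends to [tau / i.+1]. *)
Lemma poisson_cvg (p : nat -> R) g tau : (forall n, 0 <= p n <= 1) ->
  n%:R * p n @[n --> \oo] --> tau -> (1 - p n) ^+ n @[n --> \oo] --> g ->
  forall k, binomial_lt (p n) n k @[n --> \oo] -->
    g * \sum_(0 <= i < k) tau ^+ i / i`!%:R.
Proof.
move=> p01 np pg k.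
have p_cvg0 : p n @[n --> \oo] --> (0 : R).
  have h : n%:R * p n * n%:R^-1 @[n --> \oo] --> tau * 0.
    by apply: cvgM => //; exact: cvg_invn.
  rewrite mulr0 in h; apply: cvg_trans h; apply: near_eq_cvg; near=> n.
  have n0 : (0 : R) < n%:R by near: n; exact: nbhs_infty_gtr.
  by rewrite mulrAC divff ?mul1r// gt_eqF.
have term i : 'C(n, i)%:R * p n ^+ i * (1 - p n) ^+ (n - i) @[n --> \oo] -->
    g * (tau ^+ i / i`!%:R).
  elim: i => [|i IH].
    rewrite fact0 divr1 expr0 mulr1; apply: cvg_trans pg.
    by apply: near_eq_cvg; apply: nearW => n; rewrite bin0 expr0 subn0 !mul1r.
  (* The zeros on the right stand for the limit of [p n], so that the limit has the shape of the
     ratio. *)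
  have -> : g * (tau ^+ i.+1 / (i.+1)`!%:R) =
     g * (tau ^+ i / i`!%:R) * ((tau - i%:R * 0) / (i.+1%:R * (1 - 0))).
    rewrite factS natrM exprS mulr0 !subr0 mulr1; field.
    by rewrite pnatr_eq0 -lt0n fact_gt0 addrC natr1 pnatr_eq0.
  apply: (@cvg_trans _ ('C(n, i)%:R * p n ^+ i * (1 - p n) ^+ (n - i) *
      ((n%:R * p n - i%:R * p n) / (i.+1%:R * (1 - p n))) @[n --> \oo])).
    apply: near_eq_cvg; near=> n.
    have ni : (i < n)%N by near: n; exact: nbhs_infty_gt.
    have p1 : p n < 1.
      near: n; move/cvgrPdist_lt : p_cvg0 => /(_ 1 ltr01); apply: filterS => n.
      by rewrite sub0r normrN; apply: le_lt_trans; exact: ler_norm.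
    have b : i.+1%:R * 'C(n, i.+1)%:R = (n%:R - i%:R) * 'C(n, i)%:R :> R.
      by rewrite -natrB ?(ltnW ni)// -!natrM mul_bin_left.
    have d0 : i.+1%:R * (1 - p n) != 0.
      by rewrite mulf_neq0 ?pnatr_eq0// subr_eq0 gt_eqF.
    rewrite mulrA -mulrBl; apply: (mulIf d0); rewrite divfK//.
    rewrite -(subnSK ni) !exprS.
    have -> : 'C(n, i)%:R * p n ^+ i * ((1 - p n) * (1 - p n) ^+ (n - i.+1)) *
      ((n%:R - i%:R) * p n) = ((n%:R - i%:R) * 'C(n, i)%:R) *
       (p n ^+ i * ((1 - p n) * (1 - p n) ^+ (n - i.+1)) * p n) by ring.
    by rewrite -b; ring.
  apply: cvgM => //; apply: cvgM.
    by apply: cvgB => //; apply: cvgM => //; exact: cvg_cst.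
  apply: cvgV; first by rewrite mulf_neq0 ?pnatr_eq0// subr0 oner_eq0.
  apply: cvgM; first exact: cvg_cst.
  by apply: cvgB => //; exact: cvg_cst.
under eq_cvg do rewrite binomial_ltE.
rewrite big_mkord mulr_sumr; apply: cvg_big => //.
by apply: add_continuous.
Unshelve. all: by end_near. Qed.

(* With [l n = - ln ((1 - p n) ^ n)], the logarithm bounds give
   [l n (1 - l n / n) <= n p n <= l n]. *)
Lemma cvg_onem_exp (p : nat -> R) g : (forall n, 0 <= p n <= 1) -> 0 < g ->
  (1 - p n) ^+ n @[n --> \oo] --> g -> n%:R * p n @[n --> \oo] --> - ln g.
Proof.
move=> p01 g0 pg; pose l n := - ln ((1 - p n) ^+ n).
have lg : l n @[n --> \oo] --> - ln g.
  by apply: cvgN; apply: (cvg_comp _ _ pg); exact: continuous_ln.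
have ln0 : l n - l n * l n * n%:R^-1 @[n --> \oo] --> - ln g.
  rewrite -[X in _ --> X]subr0 -[X in _ - X](mulr0 (- ln g * - ln g)).
  by apply: cvgB => //; apply: cvgM; [exact: cvgM|exact: cvg_invn].
have near_pos : \forall n \near \oo, (0 < n)%N /\ 0 < (1 - p n) ^+ n.
  near=> n; split; first by near: n; exact: nbhs_infty_gt.
  by near: n; apply: (cvgr_gt g).
apply: (squeeze_cvgr _ ln0 lg).
near=> n.
have [n0 q0] : (0 < n)%N /\ 0 < (1 - p n) ^+ n by near: n.
have /andP[pn0 pn1] := p01 n.
have p1 : p n < 1.
  rewrite lt_neqAle pn1 andbT; apply/eqP => pE.
  by move: q0; rewrite pE subrr expr0n gtn_eqF// ltxx.
have q1 : 0 < 1 - p n by rewrite subr_gt0.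
have lE : l n = - ln (1 - p n) * n%:R by rewrite /l lnXn// -mulNrn mulr_natr.
have nr0 : 0 < n%:R :> R by rewrite ltr0n.
have up : p n <= - ln (1 - p n).
  by rewrite lerNr; apply: le_ln1Dx; rewrite ltrN2.
have lo : - ln (1 - p n) * (1 - p n) <= p n.
  rewrite -ler_pdivlMr// -lnV ?posrE//.
  rewrite [X in ln X](_ : _ = 1 + p n / (1 - p n)); last by field; rewrite gt_eqF.
  by apply: le_ln1Dx; rewrite (lt_le_trans (ltrN10 _))// divr_ge0// ltW.
rewrite lE; set L := - ln _ in up lo *; apply/andP; split; last by nra.
have -> : L * n%:R - L * n%:R * (L * n%:R) * n%:R^-1 = (L * (1 - L)) * n%:R.
  by field; rewrite gt_eqF.
rewrite mulrC ler_pM2l//; nra.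
Unshelve. all: by end_near. Qed.

End Poisson.

(** * Equality of laws, order statistics and choice of parameters *)

Lemma same_cdf_same_law d (T : measurableType d) (R : realType)
    (P : probability T R) (X Y : {RV P >-> R}) : cdf X =1 cdf Y ->
  forall A, measurable A -> P (X @^-1` A) = P (Y @^-1` A).
Proof.
move=> XY A mA.
(* Uniqueness of Lebesgue-Stieltjes measures is stated on [measurableTypeR R], which
   has the sigma-algebra of [R] but another display. *)
pose bX : {mfun T >-> measurableTypeR R} := HB.pack (X : T -> measurableTypeR R)
  (isMeasurableFun.Build _ _ T (measurableTypeR R) X (measurable_funPT X)).
pose bY : {mfun T >-> measurableTypeR R} := HB.pack (Y : T -> measurableTypeR R)
  (isMeasurableFun.Build _ _ T (measurableTypeR R) Y (measurable_funPT Y)).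
(* The law of [Y] is the Lebesgue-Stieltjes measure of its cdf. By uniqueness it is enough that the
   law of [X] gives each half-open interval the same increment. *)
have hY := @lebesgue_stieltjes_cdf_id R (distribution P bY) A mA.
change (distribution P bX A = distribution P bY A).
rewrite -hY; apply/esym/lebesgue_stieltjes_measure_unique => // _ [[a b] /= _ <-].
rewrite lebesgue_stieltjes_cdf_id//= /distribution /pushforward.
have [ab|ba] := leP a b; last first.
  by rewrite set_itv_ge ?preimage_set0 ?measure0// bnd_simp -leNgt ltW.
have -> : `]a, b]%classic = `]-oo, b] `\` `]-oo, a] :> set R.
  by rewrite -[RHS]setCK setCD setCitvl setUC -[LHS]setCK setCitv.
have lawD (Z : {RV P >-> R}) :
    P (Z @^-1` (`]-oo, b] `\` `]-oo, a])) = (cdf Z b - cdf Z a)%E.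
  have -> : P (Z @^-1` (`]-oo, b] `\` `]-oo, a])) =
    distribution P Z (`]-oo, b] `\` `]-oo, a]) by [].
  rewrite measureD//; first by rewrite setIidr//; apply: subset_itvl; rewrite bnd_simp.
  by rewrite -ge0_fin_numE// fin_num_measure.
by rewrite (lawD X) (lawD Y) !XY.
Qed.

(** In the decreasing rearrangement the entries above [v] form an initial segment; the entry of
    index [k.-1] is outside it exactly when the segment has fewer than [k] entries. *)
Lemma nth_sort_ge_le (R : realType) (s : seq R) (v : R) (k : nat) :
  (0 < k <= size s)%N ->
  (nth 0 (sort >=%R s) k.-1 <= v) = (count (fun x => (v < x)%R) s < k)%N.
Proof.
move=> /andP[k0 ks].
have tot : total (>=%R : rel R) by move=> a b; exact: le_total.
have tr : transitive (>=%R : rel R) by move=> a b c ba /le_trans; apply.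
have refl : reflexive (>=%R : rel R) by move=> a; exact: lexx.
have srt := sort_sorted tot s.
rewrite -(permP (permEl (perm_sort >=%R s))) -(size_sort >=%R) in ks *.
set t := sort _ s in srt ks *.
have mono i j : (i <= j)%N -> (j < size t)%N -> nth 0 t j <= nth 0 t i.
  move=> ij js; apply: (sorted_leq_nth tr refl 0 srt) => //; rewrite ?inE//.
  exact: leq_ltn_trans js.
have [tv|tv] := leP (nth 0 t k.-1) v.
  apply/esym; rewrite -(cat_take_drop k.-1 t) count_cat.
  have -> : count (fun x => v < x) (drop k.-1 t) = 0%N.
    apply/eqP; rewrite -leqn0 leqNgt -has_count; apply/hasPn => z /(nthP 0)[i].
    rewrite size_drop nth_drop => hi <-; rewrite -leNgt; apply: le_trans tv.
    by apply: mono; rewrite ?leq_addr// -ltn_subRL.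
  rewrite addn0 (leq_ltn_trans (count_size _ _))// size_takel ?prednK//.
  by rewrite (leq_trans (leq_pred _)).
apply/esym/negbTE; rewrite -leqNgt -(cat_take_drop k t) count_cat.
apply: leq_trans (leq_addr _ _).
have : all (fun x => v < x) (take k t).
  apply/(all_nthP 0) => i; rewrite size_takel// => ik.
  rewrite nth_take//; apply: (lt_le_trans tv); apply: mono.
    by rewrite -ltnS prednK.
  by rewrite prednK.
by rewrite all_count size_takel// => /eqP ->.
Qed.

Lemma kth_max_le (T : Type) (R : realType) (X : nat -> T -> R) (k n : nat)
    (w : T) (v : R) :
  (0 < k <= n)%N ->
  (kth_max X k n w <= v) = (\sum_(i < n) \1_(`]v, +oo[%classic) (X i w) < k%:R :> R).
Proof.
move=> kn; rewrite /kth_max nth_sort_ge_le ?size_map ?size_iota//.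
rewrite count_map -sum1_count big_mkcond -(ltr_nat R) natr_sum.
congr (_ < _); rewrite -{1}[n]subn0 -[iota _ _]/(index_iota 0 n) big_mkord.
apply: eq_bigr => i _; rewrite indicE /=.
have -> : (X i w \in `]v, +oo[%classic) = (v < X i w).
  by apply/idP/idP; rewrite inE/= in_itv/= andbT.
by case: (v < X i w).
Qed.

(** The ratio [dl / sigma] is fixed at a level [M] beyond which both normal tails are at most [e];
    then [dl] is made small with this ratio kept, so that the shift by [dl] and the extra variance
    [sigma ^+ 2] hardly move the argument of the distribution function. *)
Lemma smoothing_parameters (R : realType) (y e : R) : 0 < e ->
  exists dl sigma : R, [/\ 0 < dl, 0 < sigma,
    std_normal_df (- dl / sigma) <= e /\ 1 - e <= std_normal_df (dl / sigma),
    `|std_normal_df ((y + dl) / Num.sqrt (sigma ^+ 2 + 1)) - std_normal_df y| <= e &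
    `|std_normal_df ((y - dl) / Num.sqrt (sigma ^+ 2 + 1)) - std_normal_df y| <= e].
Proof.
move=> e0.
have [M [M0 hM1 hM2]] : exists M : R, [/\ 0 < M, std_normal_df (- M) <= e &
    1 - e <= std_normal_df M].
  have h1 : \forall x \near +oo, 1 - e <= @std_normal_df R x.
    have /cvgrPdist_le /(_ _ e0) := @std_normal_df_cvgy R.
    by apply: filterS => x; rewrite ler_norml => /andP[_]; lra.
  have h2 : \forall x \near -oo, @std_normal_df R x <= e.
    have /cvgrPdist_le /(_ _ e0) := @std_normal_df_cvgNy R.
    by apply: filterS => x; rewrite ler_norml => /andP[]; lra.
  have [N1 [_ hN1]] := h1; have [N2 [_ hN2]] := h2.
  exists (1 + `|N1| + `|N2|); split.
  - by rewrite !ltr_pwDl.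
  - by apply: hN2; have := ler_norm (- N2); rewrite normrN; have := normr_ge0 N1; lra.
  - by apply: hN1; have := ler_norm N1; have := normr_ge0 N2; lra.
(* The argument moves by at most [dl + |y| * (dl / M) ^+ 2], which is at most [dl * K] because
   [dl <= 1]. *)
pose K := 1 + `|y| / M ^+ 2.
have K0 : 0 < K by rewrite ltr_pwDl// divr_ge0// sqr_ge0.
pose dl := Num.min 1 (e / K).
have dl0 : 0 < dl by rewrite lt_min ltr01 divr_gt0.
have dl1 : dl <= 1 by rewrite ge_min lexx.
have dle : dl * K <= e by rewrite -ler_pdivlMr// ge_min lexx orbT.
exists dl, (dl / M).
have s0 : 0 < dl / M by rewrite divr_gt0.
have dlM : dl / (dl / M) = M by field; rewrite !gt_eqF.
have shift t : `|t| <= dl ->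
    `|std_normal_df ((y + t) / Num.sqrt ((dl / M) ^+ 2 + 1)) - std_normal_df y| <= e.
  move=> tdl; apply: (le_trans (std_normal_df_lipschitz _ _)).
  set s := Num.sqrt _.
  have s2 : s ^+ 2 = (dl / M) ^+ 2 + 1 by rewrite sqr_sqrtr// addr_ge0// sqr_ge0.
  have s1 : 1 <= s by rewrite -[leLHS]sqrtr1 ler_wsqrtr// lerDr sqr_ge0.
  have sd : s - 1 <= (dl / M) ^+ 2 by nra.
  have -> : (y + t) / s - y = t / s - y * ((s - 1) / s) by field; lra.
  have s00 : 0 < s by lra.
  apply: (le_trans (ler_normB _ _)); rewrite !normrM.
  have i1 : 0 <= s^-1 <= 1 by rewrite invr_ge0 (ltW s00) invf_le1.
  have r1 : `|(s - 1)| * `|s^-1| <= (dl / M) ^+ 2.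
    rewrite !ger0_norm; try lra.
    by apply: le_trans sd; rewrite ler_piMr; lra.
  apply: (@le_trans _ _ (dl + `|y| * (dl / M) ^+ 2)).
    apply: lerD; last by rewrite ler_wpM2l.
    apply: le_trans tdl; rewrite ler_piMr// ger0_norm; lra.
  apply: le_trans dle; rewrite /K mulrDr mulr1 lerD2l.
  rewrite expr_div_n mulrCA ler_wpM2r// ?mulr_ge0 ?invr_ge0 ?sqr_ge0//.
  by rewrite expr2 ler_piMr// ltW.
split => //.
- by split; rewrite ?mulNr dlM.
- by apply: shift; rewrite ger0_norm// ltW.
- by apply: shift; rewrite normrN ger0_norm// ltW.
Qed.

(** From [expR tau >= tau ^+ i.+1 / i.+1!] each Poisson weight of index [i < k] is at most
    [i.+1 / tau <= k / tau]. The sum is thus at most [k ^ 2 / tau], which dictates the choice of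
    [tau]. *)
Lemma poisson_tail_small (R : realType) (k : nat) (e : R) : 0 < e ->
  exists2 tau : R, 0 < tau &
    expR (- tau) * \sum_(0 <= i < k) tau ^+ i / i`!%:R <= e.
Proof.
move=> e0; pose tau : R := k%:R * k%:R / e + 1.
have tau0 : 0 < tau by rewrite ltr_wpDl// divr_ge0 ?mulr_ge0// ltW.
exists tau => //; rewrite mulr_sumr.
apply: (@le_trans _ _ (\sum_(0 <= i < k) k%:R / tau)).
  rewrite !big_mkord; apply: ler_sum => i _.
  have h := expR_ge1Dxn i (ltW tau0).
  rewrite expRN mulrC ler_pdivrMr ?expR_gt0//.
  have -> : tau ^+ i / i`!%:R = i.+1%:R / tau * (tau ^+ i.+1 / (i.+1)`!%:R).
    rewrite factS natrM exprS; field.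
    by rewrite pnatr_eq0 -lt0n fact_gt0 addrC natr1 pnatr_eq0/= gt_eqF.
  apply: ler_pM.
  - by rewrite divr_ge0// ltW.
  - by rewrite divr_ge0// exprn_ge0// ltW.
  - by rewrite ler_wpM2r ?invr_ge0 ?(ltW tau0)// ler_nat.
  - by apply: le_trans h; rewrite lerDr.
rewrite big_const_nat subn0 iter_addr_0 -(mulr_natl (_ / _)) mulrA ler_pdivrMr//.
rewrite /tau mulrDr mulr1 mulrCA divff ?gt_eqF// mulr1.
by rewrite lerDl ltW.
Qed.

(** * Joint limit *)

(** The arithmetic that ends [joint_limit]: [v] is the probability studied, [vP] and [vN] are its
    smoothed upper and lower versions, [q] is the limit. *)
Lemma sandwich_norm_le (R : realFieldType) (q r vP vN v eta e : R) :
  v <= vP + eta -> vN <= v + eta -> r + eta = e / 2 ->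
  `|vP - q| <= e / 4 + e / 4 + r -> `|vN - q| <= e / 4 + e / 4 + r ->
  `|q - v| <= e.
Proof.
rewrite !ler_norml => vP_ge vN_le re /andP[h1 h2] /andP[h3 h4].
by apply/andP; split; lra.
Qed.

Definition exceed_event (T : Type) (R : realType) (X : nat -> T -> R)
    (u : R) (n k : nat) (B : set R) : set T :=
  [set w | \sum_(i < n) \1_(`]u, +oo[%classic) (X i w) < k%:R :> R /\
           B (\sum_(i < n) X i w)].

Section JointLimit.
Context d (T : measurableType d) (R : realType) (P : probability T R).
Variable X : nat -> {RV P >-> R}.
Hypothesis hindep : mutually_independent X.
Hypothesis hid : forall i A, measurable A -> P (X i @^-1` A) = P (X 0%N @^-1` A).
Local Notation mu := (distribution P (X 0%N)).
Local Notation Phi := (@std_normal_df R).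
Local Notation st u := (state X (count_sum_step u) (0, 0)).
Local Notation upper u := (fine (mu `]u, +oo[%classic)).
Hypothesis int2 : mu.-integrable setT (EFin \o (fun x : R => x ^+ 2)).
Hypothesis mean0 : \int[mu]_x x = 0.
Hypothesis var1 : \int[mu]_x x ^+ 2 = 1.

(** After [m] genuine summands, [n - m] are still Gaussian, so the test function [W m] carries the
    variance [v m = sigma ^+ 2 + (n - m) / n]. At [m = n] only the smoothing by [sigma] is left; at
    [m = 0] the value is that of the fully Gaussian sum. *)
Lemma gaussian_hybrid (u sigma y : R) (n k : nat) : 0 < sigma -> (0 < n)%N ->
  (Num.sqrt n%:R)^-1 <= sigma ->
  `|weighted_mean X u (fun r => Phi ((y - r / Num.sqrt n%:R) / sigma)) n k -
    binomial_lt (upper u) n k * Phi (y / Num.sqrt (sigma ^+ 2 + 1))| <=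
  n%:R * step_error mu sigma u n.
Proof.
move=> s0 n0 cs; set c := (Num.sqrt n%:R)^-1 in cs *.
have nr0 : 0 < n%:R :> R by rewrite ltr0n.
have c0 : 0 < c by rewrite invr_gt0 sqrtr_gt0.
have c2 : c ^+ 2 = n%:R^-1 by rewrite /c exprVn sqr_sqrtr.
pose v (m : nat) : R := sigma ^+ 2 + (n - m)%:R / n%:R.
have v_ge m : sigma ^+ 2 <= v m by rewrite /v lerDl divr_ge0.
have v0 m : 0 < v m by apply: lt_le_trans (v_ge m); rewrite exprn_gt0.
pose W (m : nat) (r : R) : R := Phi ((y - r * c) / Num.sqrt (v m)).
have := @hybrid _ _ _ _ _ hindep hid u W (step_error mu sigma u n) n _ _ _ n k (leqnn n).
have WE : (fun r => Phi ((y - r * c) / sigma)) = W n.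
  by apply/funext => r; rewrite /W /v subnn mul0r addr0 sqrtr_sqr gtr0_norm.
have W0 : Phi (y / Num.sqrt (sigma ^+ 2 + 1)) = W 0%N 0.
  by rewrite /W /v mul0r subr0 subn0 divff// gt_eqF.
rewrite WE W0; apply.
- move=> m; apply: measurableT_comp; first exact: measurable_std_normal_df.
  apply: measurable_funM => //; apply: measurable_funB => //.
  exact: measurable_funM.
- by move=> m s; rewrite std_normal_df_ge0 std_normal_df_le1.
move=> m s mn; set w := v m.+1.
have w0 : 0 < w := v0 _.
have sw0 : 0 < Num.sqrt w by rewrite sqrtr_gt0.
have sw2 : Num.sqrt w ^+ 2 = w by rewrite sqr_sqrtr// ltW.
pose z := (y - s * c) / Num.sqrt w; pose h := c / Num.sqrt w.
have ssw : sigma <= Num.sqrt w.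
  by rewrite -(gtr0_norm s0) -sqrtr_sqr ler_wsqrtr// v_ge.
have hk : h <= c / sigma by rewrite ler_wpM2l ?(ltW c0)// lef_pV2.
have h0 : 0 <= h by rewrite divr_ge0// ltW.
have h1 : h <= 1 by rewrite ler_pdivrMr// mul1r (le_trans cs).
have h01 : 0 <= h <= 1 by rewrite h0.
(* One more Gaussian summand raises the variance by [1 / n = c ^+ 2]. In units of [w] this is the
   factor [1 + h ^+ 2] of the one-step lemmas, and [h] is at most [c / sigma] for every [m]. *)
have vw : v m = w * (1 + h ^+ 2).
  rewrite /h expr_div_n sw2 c2 /w /v -(subnSK mn) -natr1; field.
  by rewrite !gt_eqF// ltr_pwDl// mulr_gt0// exprn_gt0.
have Wm : W m s = Phi (z / Num.sqrt (1 + h ^+ 2)).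
  by rewrite /W /z vw sqrtrM ?(ltW w0)// invfM mulrA.
have WS x : W m.+1 (s + x) = Phi (z - h * x).
  rewrite /W -/w /z /h; congr Phi; field; by rewrite gt_eqF.
rewrite /lower_step /upper_step Wm.
under eq_Rintegral do rewrite WS.
under [X in _ + `|X - _|]eq_Rintegral do rewrite WS.
apply: (le_trans (lerD (step_below int2 mean0 var1 u z h01) (step_above int2 u z h01))).
set K := c / sigma.
have K0 : 0 <= K by rewrite (le_trans h0).
have p0 : 0 <= upper u by rewrite fine_ge0.
have I0 : 0 <= \int[mu]_(x in `]u, +oo[) `|x| by exact: Rintegral_ge0.
have hK2 : h ^+ 2 <= K ^+ 2 by rewrite lerXn2r.
have hK4 : h ^+ 4 <= K ^+ 4 by rewrite lerXn2r.
have T0 := truncated_moment_ge0 mu h0.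
have TK := truncated_moment_le int2 h0 hk.
have b1 : h ^+ 2 * truncated_moment mu h <= K ^+ 2 * truncated_moment mu K.
  by apply: ler_pM => //; exact: sqr_ge0.
have b2 : h * \int[mu]_(x in `]u, +oo[) `|x| <= K * \int[mu]_(x in `]u, +oo[) `|x|.
  by rewrite ler_wpM2r.
have b3 : upper u * (4 * h ^+ 2) <= upper u * (4 * K ^+ 2).
  by apply: ler_wpM2l => //; apply: ler_wpM2l.
have -> : step_error mu sigma u n = 2 * (K ^+ 2 * truncated_moment mu K) + 3 * K ^+ 4 +
  2 * (K * \int[mu]_(x in `]u, +oo[) `|x| + upper u * (4 * K ^+ 2)) by [].
move: b1 b2 b3 hK4; clear.
move: (h ^+ 2 * _) (K ^+ 2 * _) (h * _) (K * _).
move: (upper u * _) (upper u * _) (h ^+ 4) (K ^+ 4).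
move=> x1 x2 x3 x4 x5 x6 x7 x8; lra.
Qed.

Lemma measurable_exceed_event u n k B : measurable B ->
  measurable (exceed_event X u n k B).
Proof.
move=> mB; pose A := (fun w => (st u n w).1) @^-1` `]-oo, k%:R[%classic `&`
  (fun w => (st u n w).2) @^-1` B.
have -> : exceed_event X u n k B = A.
  apply/seteqP; split => w; rewrite /exceed_event /A/= state_count_sum/= in_itv//=.
apply: measurableI; rewrite -[X in measurable X]setTI.
  by apply: measurable_state_fst.
by apply: measurable_state_snd.
Qed.

Lemma prob_exceed_event u n k B : measurable B ->
  fine (P (exceed_event X u n k B)) = weighted_mean X u \1_B n k.
Proof.
move=> mB; rewrite /weighted_mean /Rintegral.
rewrite -[X in P X]setIT -integral_indic//; last first.
  exact: measurable_exceed_event.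
congr fine; apply: eq_integral => w _; congr EFin.
rewrite state_count_sum/= !indicE -natrM mulnb; congr ((nat_of_bool _)%:R).
by apply/idP/andP; rewrite !inE/= in_itv/=.
Qed.

Lemma weighted_mean_leD u n k (W W' : R -> R) (e : R) :
  measurable_fun setT W -> (forall s, 0 <= W s <= 1) ->
  measurable_fun setT W' -> (forall s, 0 <= W' s <= 1) -> 0 <= e ->
  (forall s, W s <= W' s + e) ->
  weighted_mean X u W n k <= weighted_mean X u W' n k + e.
Proof.
move=> mW W01 mW' W01' e0 WW'.
have i1 := integrable_weighted X u mW W01 n k.
have i2 := integrable_weighted X u mW' W01' n k.
have ie : P.-integrable setT (EFin \o cst e) by exact: finite_measure_integrable_cst.
have <- : \int[P]_(w in setT) e = e.
  by rewrite Rintegral_cst// [X in fine X]probability_setT mulr1.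
rewrite -RintegralD//; apply: le_Rintegral => //; first exact: integrable_add.
move=> w _; rewrite indicE; case: (_ \in _); rewrite ?mul1r ?mul0r ?add0r//.
Qed.

(** For the constant test function 1 every step of the hybrid argument is exact, so the error
    [dl = 0] is admissible. *)
Lemma no_exceedance_prob u n : fine (P (exceed_event X u n 1 setT)) = (1 - upper u) ^+ n.
Proof.
rewrite prob_exceed_event// (_ : \1_setT = cst 1 :> (R -> R)); last first.
  by apply/funext => x; rewrite indicE in_setT.
have mU : measurable (`]u, +oo[%classic : set R) by [].
have h : `|weighted_mean X u (cst 1) n 1 - binomial_lt (upper u) n 1 * cst 1 (0 : R)| <=
    n%:R * 0.
  apply: (@hybrid _ _ _ _ _ hindep hid u (fun=> cst 1) 0 n) => //.
  - by move=> _ s; rewrite /= ler01 lexx.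
  - move=> m s _; rewrite /lower_step /upper_step !Rintegral_cst// !mul1r !mulr1.
    rewrite subrr normr0 addr0 normr_le0 subr_eq0; apply/eqP.
    have <- : ~` `]u, +oo[%classic = `]-oo, u]%classic by rewrite setCitvr.
    by rewrite [X in fine X = _]probability_setC// fineB ?fin_num_measure.
move: h; rewrite mulr0 normr_le0 subr_eq0 mulr1 binomial_ltE big_ord1 bin0 expr0.
by rewrite !mul1r subn0 => /eqP.
Qed.

Variables (u : nat -> R) (g : R).
Hypothesis g0 : 0 < g.
Hypothesis hmax : fine (P (exceed_event X (u n) n 1 setT)) @[n --> \oo] --> g.

(** The indicator of [s / c <= y] lies between [V (- dl) - eta] and [V dl + eta]. For both smoothed
    functions the mean is close to the binomial probability times a normal factor near [Phi y]. *)
Lemma joint_limit (k : nat) (y : R) :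
  fine (P (exceed_event X (u n) n k [set s | s / Num.sqrt n%:R <= y])) @[n --> \oo] -->
  g * (\sum_(0 <= i < k) (- ln g) ^+ i / i`!%:R) * Phi y.
Proof.
pose p n := upper (u n).
have p01 n : 0 <= p n <= 1 by exact: prob_upper01.
have qg : (1 - p n) ^+ n @[n --> \oo] --> g.
  apply: cvg_trans hmax; apply: near_eq_cvg; apply: nearW => n.
  by rewrite no_exceedance_prob.
have np := cvg_onem_exp p01 g0 qg.
have bl := @poisson_cvg _ _ _ _ p01 np qg k.
set B := g * _ in bl *.
apply/cvgrPdist_le => e e0.
(* The budget is [e / 4] for the replacement error, [e / 4] for the Poisson approximation,
   [|B| * eta] for the normal factor and [eta] for the smoothed indicator. *)
pose eta := e / (2 * (`|B| + 1)).
have B1 : 0 < `|B| + 1 by rewrite ltr_wpDl.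
have eta0 : 0 < eta by rewrite divr_gt0// mulr_gt0.
have Beta : `|B| * eta + eta = e / 2.
  by rewrite /eta; field; rewrite gt_eqF.
have [dl [sigma [dl0 s0 [tN tP] sP sN]]] := smoothing_parameters y eta0.
have err := step_error_cvg0 int2 s0 np.
near=> n.
have n0 : (0 < n)%N by near: n; exact: nbhs_infty_gt.
have cs : (Num.sqrt (n%:R : R))^-1 <= sigma by near: n; exact: near_inv_sqrt_le.
have errn : n%:R * step_error mu sigma (u n) n <= e / 4.
  have : `|0 - n%:R * step_error mu sigma (u n) n| <= e / 4.
    by near: n; move/cvgrPdist_le : err; apply; rewrite divr_gt0.
  by rewrite sub0r normrN; apply: le_trans; exact: ler_norm.
have bln : `|B - binomial_lt (p n) n k| <= e / 4.
  by near: n; move/cvgrPdist_le : bl; apply; rewrite divr_gt0.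
set c := Num.sqrt (n%:R : R).
have mA : measurable [set s : R | s / c <= y].
  rewrite (_ : [set s | _] = (fun s => s / c) @^-1` `]-oo, y]); last first.
    by apply/seteqP; split => s /=; rewrite in_itv.
  have mc : measurable_fun setT (fun s : R => s / c) by exact: measurable_funM.
  by rewrite -[X in measurable X]setTI; exact: mc.
rewrite prob_exceed_event//.
pose V t (r : R) := Phi ((y + t - r / c) / sigma).
have mV t : measurable_fun setT (V t).
  apply: measurableT_comp; first exact: measurable_std_normal_df.
  apply: measurable_funM => //; apply: measurable_funB => //.
  exact: measurable_funM.
have V01 t s : 0 <= V t s <= 1 by rewrite std_normal_df_ge0 std_normal_df_le1.
have m1 : measurable_fun setT (\1_[set s : R | s / c <= y] : R -> R).
  exact: measurable_indic.
have I01 (s : R) : 0 <= (\1_[set s : R | s / c <= y] : R -> R) s <= 1.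
  by rewrite indicE; case: (_ \in _); rewrite ?lexx ?ler01.
have up : weighted_mean X (u n) \1_[set s : R | s / c <= y] n k <=
    weighted_mean X (u n) (V dl) n k + eta.
  apply: weighted_mean_leD => //; first exact: ltW.
  move=> s; rewrite indicE; case: (boolP (_ \in _)) => [|_]; last first.
    by rewrite addr_ge0 ?(ltW eta0)//; case/andP: (V01 dl s).
  rewrite inE/= => sy; suff : Phi (dl / sigma) <= V dl s by move: tP; lra.
  apply: std_normal_df_nondecreasing; rewrite ler_wpM2r ?invr_ge0 ?(ltW s0)//; lra.
have lo : weighted_mean X (u n) (V (- dl)) n k <=
    weighted_mean X (u n) \1_[set s : R | s / c <= y] n k + eta.
  apply: weighted_mean_leD => //; first exact: ltW.
  move=> s; rewrite indicE; case: (boolP (_ \in _)) => [_|].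
    by have /andP[_ /le_trans] := V01 (- dl) s; apply; rewrite lerDl ltW.
  rewrite notin_setE/= => /negP; rewrite -ltNge => sy.
  rewrite add0r; apply: le_trans tN; apply: std_normal_df_nondecreasing.
  by rewrite ler_wpM2r ?invr_ge0 ?(ltW s0)//; lra.
have gP := gaussian_hybrid (u n) (y + dl) k s0 n0 cs.
have gN := gaussian_hybrid (u n) (y - dl) k s0 n0 cs.
rewrite -/c -/(p n) in gP gN.
set wP := weighted_mean X (u n) (V dl) n k in up gP.
set wN := weighted_mean X (u n) (V (- dl)) n k in lo gN.
set w := weighted_mean _ _ \1_ _ _ _ in up lo *.
set FP := Phi ((y + dl) / _) in sP gP.
set FN := Phi ((y - dl) / _) in sN gN.
set b := binomial_lt _ _ _ in bln gP gN.
have FP01 : 0 <= FP <= 1 by rewrite std_normal_df_ge0 std_normal_df_le1.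
have FN01 : 0 <= FN <= 1 by rewrite std_normal_df_ge0 std_normal_df_le1.
have main (F W : R) : 0 <= F <= 1 -> `|F - Phi y| <= eta ->
    `|W - b * F| <= n%:R * step_error mu sigma (u n) n ->
    `|W - B * Phi y| <= e / 4 + e / 4 + `|B| * eta.
  move=> /andP[F0 F1] Fy WF.
  have -> : W - B * Phi y = (W - b * F) - (B - b) * F + B * (F - Phi y) by ring.
  apply: (le_trans (ler_normD _ _)); apply: lerD; last first.
    by rewrite normrM ler_wpM2l.
  apply: (le_trans (ler_normB _ _)); apply: lerD; first exact: le_trans WF errn.
  by rewrite normrM (ger0_norm F0); apply: le_trans bln; rewrite ler_piMr.
exact: (sandwich_norm_le up lo Beta (main _ _ FP01 sP gP) (main _ _ FN01 sN gN)).
Unshelve. all: by end_near. Qed.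

End JointLimit.

(** * Reduction of the theorem to exceedances and to the common law *)

Section Event.
Variables (T : Type) (R : realType) (X : nat -> T -> R).

Lemma kth_max_event (k n : nat) (a b x : R) (B : set R) : (0 < k <= n)%N -> 0 < a ->
  [set w | a * (kth_max X k n w - b) <= x /\ B (partial_sum X n w)] =
  exceed_event X (b + x / a) n k B.
Proof.
move=> kn a0; have key w :
    (a * (kth_max X k n w - b) <= x) = (kth_max X k n w <= b + x / a).
  by rewrite -lerBlDl ler_pdivlMr// mulrC.
by apply/seteqP; split => w; rewrite /exceed_event/= -kth_max_le// key.
Qed.

Lemma sample_max_event (n : nat) (a b x : R) : (0 < n)%N -> 0 < a ->
  [set w | a * (sample_max X n w - b) <= x] = exceed_event X (b + x / a) n 1 setT.
Proof.
move=> n0 a0; rewrite -kth_max_event//.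
by apply/seteqP; split => w/=; rewrite kth_max1// => -[].
Qed.

End Event.

Section Moments.
Context d (T : measurableType d) (R : realType) (P : probability T R).
Variable X : {RV P >-> R}.
Hypothesis hvar : ('E_P[fun w => (X w ^+ 2)%R] = 1)%E.
Local Notation mu := (distribution P X).

Let int_sqr : (\int[mu]_x (x ^+ 2)%:E = 1)%E.
Proof.
rewrite ge0_integral_distribution//.
- by rewrite -hvar unlock.
- by apply/measurable_EFinP; exact: measurable_funX.
- by move=> x; rewrite lee_fin sqr_ge0.
Qed.

Lemma distribution_integrable_sqr :
  mu.-integrable setT (EFin \o (fun x : R => x ^+ 2)).
Proof.
apply/integrableP; split; first by apply/measurable_EFinP; exact: measurable_funX.
rewrite (eq_integral (fun x : R => (x ^+ 2)%:E)) ?int_sqr ?ltry// => x _.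
by rewrite /= ger0_norm ?sqr_ge0.
Qed.

Lemma distribution_second_moment : \int[mu]_x x ^+ 2 = 1.
Proof. by rewrite /Rintegral int_sqr. Qed.

(** Transporting the mean to the law requires that [X] be integrable; this follows from the second
    moment, as [|x| <= 1 + x ^+ 2]. *)
Lemma distribution_mean : ('E_P[X] = 0)%E -> \int[mu]_x x = 0.
Proof.
move=> hmean; rewrite /Rintegral integral_distribution//.
  by move: hmean; rewrite unlock => ->.
have := integrable_id distribution_integrable_sqr measurableT.
move=> /integrableP[_ h]; apply/integrableP; split.
  by apply/measurable_EFinP.
move: h; rewrite ge0_integral_distribution//.
by apply: measurableT_comp => //; apply/measurable_EFinP.
Qed.

End Moments.

(** Only the Frechet law vanishes, and only for [x <= 0]. There the witness
    [x' = tau ^ (- 1 / alpha)] is positive and solves [x' ^ (- alpha) = tau]. *)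
Lemma extreme_value_df_gt0 (R : realType) (G : R -> R) :
  [\/ G = @gumbel_df R,
      exists2 alpha : R, 2 < alpha & G = frechet_df alpha
    | exists2 alpha : R, 0 < alpha & G = weibull_df alpha] ->
  forall x, 0 < G x \/ G x = 0 /\ (forall tau, 0 < tau ->
    exists2 x', x <= x' & G x' = expR (- tau)).
Proof.
case=> [->|[al al2 ->]|[al al0 ->]] x.
- by left; exact: expR_gt0.
- rewrite {1 2}/frechet_df; case: (leP x 0) => [x0|_]; last by left; exact: expR_gt0.
  right; split => // tau tau0; exists (tau `^ (- al^-1)).
    exact: le_trans x0 (powR_ge0 _ _).
  rewrite /frechet_df leNgt powR_gt0//= -powRrM mulrNN mulVf ?powRr1 ?ltW//.
  by rewrite gt_eqF// (lt_trans _ al2).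
- by left; rewrite /weibull_df; case: ifP => _; [exact: expR_gt0|exact: ltr01].
Qed.

Theorem theorem2p3 (d : measure_display) (T : measurableType d) (R : realType)
    (P : probability T R) (X : nat -> {RV P >-> R}) (F : R -> R)
    (hindep : mutually_independent X)
    (hF : forall (i : nat) (x : R), cdf (X i) x = (F x)%:E)
    (hnondeg : ~ degenerate_df F)
    (hmean : ('E_P[X 0%N] = 0)%E)
    (hvar : ('E_P[fun w => (X 0%N w ^+ 2)%R] = 1)%E)
    (a b : nat -> R) (ha : forall n : nat, (0 < n)%N -> 0 < a n)
    (G : R -> R)
    (hG : [\/ G = @gumbel_df R,
              exists2 alpha : R, 2 < alpha & G = frechet_df alpha
            | exists2 alpha : R, 0 < alpha & G = weibull_df alpha])
    (hmax : forall x : R,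
      P [set w | a n * (sample_max X n w - b n) <= x] @[n --> \oo]
        --> (G x)%:E) :
  forall k : nat, (0 < k)%N -> forall x y : R,
    P [set w | a n * (kth_max X k n w - b n) <= x /\
               partial_sum X n w / Num.sqrt n%:R <= y] @[n --> \oo]
      --> (G x * (\sum_(0 <= i < k) (- ln (G x)) ^+ i / i`!%:R)
           * std_normal_df y)%:E.
Proof.
move=> k k0 x y.
have hid i A : measurable A -> P (X i @^-1` A) = P (X 0%N @^-1` A).
  by apply: same_cdf_same_law => r; rewrite !hF.
have int2 := distribution_integrable_sqr hvar.
have mean0 := distribution_mean hvar hmean.
have var1 := distribution_second_moment hvar.
pose E x n : set T := [set w | a n * (kth_max X k n w - b n) <= x /\
               partial_sum X n w / Num.sqrt n%:R <= y].
pose c n : R := Num.sqrt n%:R.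
have mA n : measurable [set s : R | s / c n <= y].
  rewrite (_ : [set s | _] = (fun s => s / c n) @^-1` `]-oo, y]); last first.
    by apply/seteqP; split => s /=; rewrite in_itv.
  have mc : measurable_fun setT (fun s : R => s / c n) by exact: measurable_funM.
  by rewrite -[X in measurable X]setTI; exact: mc.
(* For [n < k] the default value of [kth_max] may break this identity, so measurability and
   finiteness are used only for large [n]. *)
have EE z n : (k <= n)%N ->
    E z n = exceed_event X (b n + z / a n) n k [set s | s / c n <= y].
  move=> kn; have n0 : (0 < n)%N by exact: leq_trans kn.
  have kn' : (0 < k <= n)%N by rewrite k0.
  exact: (@kth_max_event _ _ X k n _ _ _ [set s | s / c n <= y] kn' (ha n n0)).
have mE z n : (k <= n)%N -> measurable (E z n).
  by move=> kn; rewrite EE//; exact: measurable_exceed_event.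
have finE z : \forall n \near \oo, P (E z n) \is a fin_num.
  near=> n; apply: fin_num_measure; apply: mE.
  by near: n; exact: nbhs_infty_ge.
have pos z : 0 < G z -> P (E z n) @[n --> \oo] -->
    (G z * (\sum_(0 <= i < k) (- ln (G z)) ^+ i / i`!%:R) * std_normal_df y)%:E.
  move=> Gz; have hz := hmax z.
  have hz' : fine (P (exceed_event X (b n + z / a n) n 1 setT)) @[n --> \oo] --> G z.
    move/fine_cvg : hz; apply: cvg_trans; apply: near_eq_cvg; near=> n.
    have n0 : (0 < n)%N by near: n; exact: nbhs_infty_gt.
    by rewrite /= sample_max_event// ha.
  have := @joint_limit _ _ _ _ _ hindep hid int2 mean0 var1 _ _ Gz hz' k y.
  move=> lim; apply: cvg_EFin; first exact: finE.
  apply: cvg_trans lim; apply: near_eq_cvg; near=> n.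
  by rewrite /= EE//; near: n; exact: nbhs_infty_ge.
have [Gx|[Gx0 small]] := extreme_value_df_gt0 hG x; first exact: pos.
(* The factor [G x] makes the limit 0 whatever the value of [ln 0]. *)
rewrite Gx0 !mul0r.
apply: cvg_EFin; first exact: finE.
apply/cvgrPdist_le => e e0.
have e2 : 0 < e / 2 by rewrite divr_gt0.
(* The event grows with [x]. It is compared with the one at a point [x' >= x] where
   [G x' = expR (- tau)] is positive, so that its limit is known, and small by the choice of
   [tau]. *)
have [tau tau0 tail] := poisson_tail_small k e2.
have [x' xx' Gx'] := small _ tau0.
have Gx'0 : 0 < G x' by rewrite Gx' expR_gt0.
pose L := expR (- tau) * (\sum_(0 <= i < k) tau ^+ i / i`!%:R) * std_normal_df y.
have lim : fine (P (E x' n)) @[n --> \oo] --> L.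
  by have /fine_cvg := pos _ Gx'0; rewrite Gx' expRK opprK.
have Le : L <= e / 2.
  rewrite /L /= -[leRHS]mulr1; apply: ler_pM => //; last exact: std_normal_df_le1.
  - rewrite mulr_ge0 ?expR_ge0// big_mkord sumr_ge0// => i _.
    by rewrite divr_ge0// exprn_ge0// ltW.
  - exact: std_normal_df_ge0.
near=> n.
have kn : (k <= n)%N by near: n; exact: nbhs_infty_ge.
have n0 : (0 < n)%N by exact: leq_trans kn.
have limn : `|L - fine (P (E x' n))| <= e / 2.
  by near: n; move/cvgrPdist_le : lim; apply.
rewrite sub0r normrN ger0_norm ?fine_ge0//=.
apply: (@le_trans _ _ (fine (P (E x' n)))).
  apply: fine_le; try by apply: fin_num_measure; exact: mE.
  apply: le_measure; rewrite ?inE; [exact: mE|exact: mE|].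
  by move=> w [h1 h2]; split => //; exact: le_trans h1 xx'.
by move: limn; rewrite ler_norml => /andP[]; lra.
Unshelve. all: by end_near. Qed.
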